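(* Let $n\ge1$ and $\lambda\vdash n$. Then $$K_{\lambda,1^n}(0,t)=\sum_{A} t^{\mathrm{spin}(A)},$$ where the sum is over all affine Bruhat counter-tableaux $A$ with $k=n$, of $n$-weight $(1^n)$ and inner shape $\lambda$.
   Context: Take $k=n$. Partitions are drawn in French notation (row $i$ counted from the bottom has $\lambda_i$ cells $(i,j)$, $1\le j\le\lambda_i$). For $\mu\subseteq\lambda$, $\lambda/\mu$ is the set of cells of $\lambda$ not in $\mu$; it is a horizontal strip if no two of its cells share a column. A $(k+1)$-core is a partition with no cell of hook length $k+1$; $\deg(\lambda)$ is the number of cells of hook length $<k+1$. $(k+\lambda_1,\lambda)$ denotes $(k+\lambda_1,\lambda_1,\lambda_2,\dots)$. Strong order on cores: $\rho\lessdot_B\gamma$ iff $\rho\subseteq\gamma$ and $\deg(\gamma)=\deg(\rho)+1$. For $0<\ell\le k$ and cores $\lambda,\nu$, $(k+\lambda_1,\lambda)/\nu$ is a bottom strong $\ell$-strip if there is a chain of cores $\nu=\nu^0\lessdot_B\cdots\lessdot_B\nu^{k-\ell}=(k+\lambda_1,\lambda)$ such that $(k+\lambda_1,\lambda)/\nu$ is a horizontal strip and for each $1\le i\le k-\ell$ the rightmost cell of the bottom row of $\nu^i$ lies in $\nu^i/\nu^{i-1}$; such a chain, when it exists, is unique. ABC of $k$-weight $(1^n)$: an array $A$ of $n$ left-justified rows numbered $1,\dots,n$ from top to bottom, each cell empty or containing a positive integer, empty cells forming an initial segment of each row, entries weakly decreasing along rows left to right and strictly decreasing up columns among nonempty cells.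 For $0\le x\le n$ let $\lambda^{(x)}$ be the partition whose $j$-th part is the number of cells of row $x+1-j$ that are empty or contain an integer $>x$. $A$ is an ABC of $k$-weight $(1^n)$ if for each $1\le i\le n$: $\lambda^{(i-1)},\lambda^{(i)}$ are $(k+1)$-cores, row $i$ has exactly $k+\lambda^{(i-1)}_1$ cells and no entry smaller than $i$, and $(k+\lambda^{(i-1)}_1,\lambda^{(i-1)})/\lambda^{(i)}$ is a bottom strong $1$-strip (whose cells are then exactly the cells of $A$ containing $i$). The inner shape is $\lambda^{(n)}$. Ribbons and spin: for each $i$, take the unique chain $\lambda^{(i)}=\nu^0\lessdot_B\cdots\lessdot_B\nu^{k-1}=(k+\lambda^{(i-1)}_1,\lambda^{(i-1)})$; the ribbons of $A$ are the rookwise-connected components of the sets $\nu^j/\nu^{j-1}$ (over all $i,j$), viewed as sets of cells of $A$; a $2$-ribbon is one with two cells (for weight $(1^n)$ these are horizontal dominoes lying in a single row). The head of a ribbon is its southeasternmost (here rightmost) cell; a ribbon is east of another if its head lies in a column strictly to the right of the other's head. Renumber the rows of $A$ from the bottom (bottom row is row $1$). Then $\mathrm{spin}(A)=\sum_i i\,\chi_i$, where $\chi_i=1$ if row $i$ contains a $2$-ribbon that is not east of a $2$-ribbon in row $i+1$, and $\chi_i=0$ otherwise. $K_{\lambda\mu}(q,t)$ denotes the coefficient of the Schur function $s_\lambda$ in the modified Macdonald polynomial $H_\mu[X;q,t]$ (Garsia–Haiman $\tilde H_\mu$); thus $K_{\lambda,1^n}(0,t)=t^{\binom n2}K_{\lambda,1^n}(t^{-1})$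 where $K_{\lambda\mu}(t)$ is the Kostka–Foulkes polynomial (e.g. $H_{1^3}[X;0,t]=t^3s_{111}+(t^2+t)s_{21}+s_3$). Since $k=n\ge|\lambda|$, this also equals the $k$-Schur coefficient $K^{(n)}_{\lambda 1^n}(0,t)$. *)

(* Defs.v *)
From mathcomp Require Import all_boot all_order all_algebra fraction.
From mathcomp Require Import mpoly.
From mathcomp Require Import boolp classical_sets.

Set Implicit Arguments.
Unset Strict Implicit.
Unset Printing Implicit Defensive.

Import GRing.Theory.

Local Open Scope nat_scope.

(* Partitions are sequences of positive parts.  Cells (i, j) are 0-based: row
   i (from the bottom, French notation) has the cells j < nth 0 la i. *)

Definition is_part (la : seq nat) : bool := sorted geq la && (0 \notin la).

Definition is_part_of (n : nat) (la : seq nat) : bool :=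
  is_part la && (sumn la == n).

Definition conj_part (la : seq nat) : seq nat :=
  mkseq (fun j => count (fun p => j < p) la) (head 0 la).

Definition included (mu la : seq nat) : bool :=
  all (fun i => nth 0 mu i <= nth 0 la i) (iota 0 (size mu)).

(* For partitions of the same size. *)
Definition dominates (la mu : seq nat) : bool :=
  all (fun m => sumn (take m mu) <= sumn (take m la)) (iota 0 (size mu).+1).

Definition cells (la : seq nat) : seq (nat * nat) :=
  [seq (i, j) | i <- iota 0 (size la), j <- iota 0 (nth 0 la i)].

(* arm + leg + 1, for c a cell of la *)
Definition hook (la : seq nat) (c : nat * nat) : nat :=
  (nth 0 la c.1 - c.2.+1) + (nth 0 (conj_part la) c.2 - c.1.+1) + 1.

Definition is_core (k : nat) (la : seq nat) : bool :=
  is_part la && all (fun c => hook la c != k.+1) (cells la).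

Definition deg (k : nat) (la : seq nat) : nat :=
  count (fun c => hook la c < k.+1) (cells la).

Definition skew_cells (la mu : seq nat) : seq (nat * nat) :=
  [seq c <- cells la | c \notin cells mu].

Definition horizontal_strip (la mu : seq nat) : bool :=
  included mu la && uniq [seq c.2 | c <- skew_cells la mu].

Definition strong_cover (k : nat) (rho gam : seq nat) : bool :=
  [&& is_core k rho, is_core k gam, included rho gam
    & deg k gam == (deg k rho).+1].

(* (k + la_1, la_1, la_2, ...) *)
Definition extend (k : nat) (la : seq nat) : seq nat := (k + head 0 la) :: la.

Definition strip_step (k : nat) (rho gam : seq nat) : bool :=
  strong_cover k rho gam && ((0, (head 0 gam).-1) \in skew_cells gam rho).

(* The chain nu^0, ..., nu^(k-l) is nu :: c. *)
Definition strip_chain (k l : nat) (la nu : seq nat) (c : seq (seq nat)) : bool :=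
  [&& 0 < l <= k, is_core k la, is_core k nu,
      horizontal_strip (extend k la) nu,
      path (strip_step k) nu c, last nu c == extend k la & size c == k - l].

Definition bottom_strong_strip (k l : nat) (la nu : seq nat) : Prop :=
  exists c : seq (seq nat), strip_chain k l la nu c.

(* An array is the sequence of its rows, from top to bottom; an empty cell is
   encoded by the entry 0. *)

Definition abc_row (A : seq (seq nat)) (i : nat) : seq nat := nth [::] A i.-1.

Definition entry (A : seq (seq nat)) (i j : nat) : nat := nth 0 (abc_row A i) j.

Definition wf_row (r : seq nat) : bool :=
  let s := drop (find (fun e => e != 0) r) r in (0 \notin s) && sorted geq s.

Definition column_strict (A : seq (seq nat)) : Prop :=
  forall i i' j : nat, 0 < i < i' -> entry A i j != 0 -> entry A i' j != 0 ->
  entry A i j < entry A i' j.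

(* lambda^(x), first with possible null parts. *)
Definition raw_shape (A : seq (seq nat)) (x : nat) : seq nat :=
  [seq count (fun e => (e == 0) || (x < e)) (abc_row A (x.+1 - j)) | j <- iota 1 x].

Definition abc_shape (A : seq (seq nat)) (x : nat) : seq nat :=
  [seq p <- raw_shape A x | 0 < p].

(* The letters of an array of weight (1^n) are 1, ..., n. *)
Definition is_ABC (k n : nat) (A : seq (seq nat)) : Prop :=
  [/\ size A = n,
      all (fun r => wf_row r && all (fun e => e <= n) r) A,
      column_strict A
    & forall i, 0 < i <= n ->
      [/\ sorted geq (raw_shape A i),
          is_core k (abc_shape A i.-1) && is_core k (abc_shape A i),
          size (abc_row A i) = k + head 0 (abc_shape A i.-1),
          all (fun e => (e == 0) || (i <= e)) (abc_row A i)
        & bottom_strong_strip k 1 (abc_shape A i.-1) (abc_shape A i)]].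

Definition inner_shape (n : nat) (A : seq (seq nat)) : seq nat := abc_shape A n.

(* A finite type containing all ABCs; see is_ABC_abc_array below. *)
Definition abc_array (k n : nat) : Type := n.-tuple ((k * n).-bseq 'I_n.+1).

Definition abc_rows (k n : nat) (A : abc_array k n) : seq (seq nat) :=
  [seq [seq val e | e <- val r] | r <- val A].

Lemma is_ABC_abc_array (k n : nat) (A : seq (seq nat)) :
  is_ABC k n A -> exists B : abc_array k n, abc_rows B = A.
Proof.
move=> [sA /allP wA _ stepA].
have geq_trans : transitive geq by move=> y x z yx /leq_trans; apply.
have head_filter s : sorted geq s -> head 0 [seq p <- s | 0 < p] <= head 0 s.
  case: s => //= x s; case: posnP => //= -> /(order_path_min geq_trans) /allP s0.
  by rewrite (@eq_in_filter _ _ pred0) ?filter_pred0 // => y /s0; case: y.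
have size_row i : i <= n -> size (abc_row A i) <= k * n.
  suff pos_row j : 0 < j <= n -> size (abc_row A j) <= k * j.
    move=> le_in; case: (posnP n) => [n0|n_gt0].
      by rewrite /abc_row nth_default // sA n0.
    case: i le_in => [|i] le_in.
      by apply: leq_trans (pos_row 1 _) _; rewrite ?leq_mul2l ?n_gt0 ?orbT.
    by apply: leq_trans (pos_row i.+1 le_in) _; rewrite leq_mul2l le_in orbT.
  elim: j => [//|j IHj] le_jn; have [_ _ -> _ _] := stepA _ le_jn.
  rewrite mulnS leq_add2l /=; case: j => [|j] in IHj le_jn *; first by [].
  have le_j : 0 < j.+1 <= n by case/andP: le_jn => _ /ltnW.
  have [srt _ _ _ _] := stepA _ le_j.
  apply: leq_trans (IHj le_j); apply: leq_trans (head_filter _ srt) _.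
  by rewrite /= subn1 count_size.
have bound_row r : r \in A -> size [seq inord e : 'I_n.+1 | e <- r] <= k * n.
  move=> rA; rewrite size_map; move: rA => /(nthP [::]) [i lt_iA <-].
  by apply: (size_row i.+1); rewrite -sA.
pose row_of r : (k * n).-bseq 'I_n.+1 := insub_bseq _ [seq inord e | e <- r].
have size_B : size [seq row_of r | r <- A] == n by rewrite size_map sA.
exists (Tuple size_B); rewrite /abc_rows /= -map_comp.
rewrite -[RHS]map_id; apply/eq_in_map => r rA /=.
have /andP [_ /allP le_r] := wA _ rA.
rewrite /row_of /insub_bseq insubdK; last exact: bound_row.
rewrite -(map_comp (@nat_of_ord n.+1)) -[RHS]map_id.
by apply/eq_in_map => e er /=; rewrite inordK // ltnS le_r.
Qed.

Definition the_chain (k : nat) (A : seq (seq nat)) (i : nat) : seq (seq nat) :=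
  xget [::] [set c | strip_chain k 1 (abc_shape A i.-1) (abc_shape A i) c]%classic.

Definition adjacent (c d : nat * nat) : bool :=
  ((c.1 == d.1) && ((c.2.+1 == d.2) || (d.2.+1 == c.2)))
  || ((c.2 == d.2) && ((c.1.+1 == d.1) || (d.1.+1 == c.1))).

Definition components (S : seq (nat * nat)) : seq (seq (nat * nat)) :=
  let e := fun a b : seq_sub S => adjacent (val a) (val b) in
  [seq [seq val y | y in connect e x] | x : seq_sub S].

(* Cell (r, j) of extend k (abc_shape A i.-1) sits in row i - r of A from the
   top, that is, in row n + 1 - (i - r) of A numbered from 1 from the bottom. *)
Definition to_array (n i : nat) (c : nat * nat) : nat * nat :=
  (n.+1 - i + c.1, c.2).

Definition ribbons (k n : nat) (A : seq (seq nat)) : seq (seq (nat * nat)) :=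
  flatten
    [seq flatten
           (pairmap (fun rho gam =>
              [seq [seq to_array n i c | c <- R]
              | R <- components (skew_cells gam rho)])
              (abc_shape A i) (the_chain k A i))
    | i <- iota 1 n].

(* Column of the southeasternmost cell of a ribbon. *)
Definition head_col (R : seq (nat * nat)) : nat := \max_(c <- R) c.2.

Definition east_of (R R' : seq (nat * nat)) : bool := head_col R' < head_col R.

Definition two_ribbons (k n : nat) (A : seq (seq nat)) (i : nat) :
    seq (seq (nat * nat)) :=
  [seq R <- ribbons k n A | (size R == 2) && all (fun c => c.1 == i) R].

Definition chi (k n : nat) (A : seq (seq nat)) (i : nat) : bool :=
  has (fun R => ~~ has (fun R' => east_of R R') (two_ribbons k n A i.+1))
      (two_ribbons k n A i).

Definition spin (k n : nat) (A : seq (seq nat)) : nat :=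
  \sum_(1 <= i < n.+1) i * chi k n A i.

Local Open Scope ring_scope.

(* Symmetric functions of degree <= n over F are represented in F[p_1,..., p_n],
   the subring of Lambda_F generated by the first n power sums: the variable
   'X_i of {mpoly F[n]} is p_(i+1). *)
Section SymmetricFunctions.

Variables (F : fieldType) (n : nat).

(* p_m, for 1 <= m <= n *)
Definition psum (m : nat) : {mpoly F[n]} :=
  if insub m.-1 is Some i then 'X_i else 0.

(* [:: h_0; ...; h_m], by Newton's identities
   m h_m = p_1 h_(m-1) + ... + p_m h_0 *)
Fixpoint hseq (m : nat) : seq {mpoly F[n]} :=
  if m is m'.+1 then
    let s := hseq m' in
    rcons s ((m%:R)^-1 *: \sum_(1 <= i < m.+1) psum i * s`_(m - i))
  else [:: 1].

Definition hsym (m : nat) : {mpoly F[n]} := (hseq m)`_m.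

(* Jacobi-Trudi: det (h_(la_i - i + j)), with h_m = 0 for m < 0 *)
Definition schur (la : seq nat) : {mpoly F[n]} :=
  \det (\matrix_(i < size la, j < size la)
     if (i <= nth 0%N la i + j)%N then hsym (nth 0%N la i + j - i) else 0).

(* f[X(1 - a)]: p_m |-> (1 - a^m) p_m *)
Definition pleth (a : F) (f : {mpoly F[n]}) : {mpoly F[n]} :=
  f \mPo [tuple (1 - a ^+ i.+1) *: 'X_i | i < n].

(* The partitions of n, all of which have at most n parts, each at most n. *)
Definition part_val (s : n.-bseq 'I_n.+1) : seq nat := [seq val p | p <- val s].

Definition schur_comb (P : pred (seq nat)) (c : seq nat -> F) : {mpoly F[n]} :=
  \sum_(s : n.-bseq 'I_n.+1 | is_part_of n (part_val s) && P (part_val s))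
     c (part_val s) *: schur (part_val s).

(* Coefficient of s_la in f, homogeneous of degree n. *)
Definition schur_coef (f : {mpoly F[n]}) (la : seq nat) : F :=
  xget 0 [set x | exists2 c, f = schur_comb xpredT c & c la = x]%classic.

End SymmetricFunctions.

(* Garsia and Haiman's characterization of H_mu[X;q,t]:
   H_mu[X(1-q)] is in the span of the s_la with la >= mu,
   H_mu[X(1-t)] is in the span of the s_la with la >= mu',
   and the coefficient of s_(n) in H_mu is 1. *)
Definition is_modified_macdonald (F : fieldType) (q t : F) (mu : seq nat)
    (H : {mpoly F[sumn mu]}) : Prop :=
  let n := sumn mu in
  let one_row := nseq (0 < n)%N n in
  [/\ exists c, pleth q H = schur_comb n (fun la => dominates la mu) c,
      exists c, pleth t H = schur_comb n (fun la => dominates la (conj_part mu)) c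
    & exists2 c, H = schur_comb n xpredT c & c one_row = 1].

Definition Qt : fieldType := {fraction {poly rat}}.
Definition Qtq : fieldType := {fraction {poly Qt}}.

Definition t_Qt : Qt := FracField.tofrac ('X : {poly rat}).
Definition q_Qtq : Qtq := FracField.tofrac ('X : {poly Qt}).
Definition t_Qtq : Qtq := FracField.tofrac (t_Qt%:P : {poly Qt}).

Definition macdonald_H (mu : seq nat) : {mpoly Qtq[sumn mu]} :=
  xget 0 [set H | is_modified_macdonald q_Qtq t_Qtq H]%classic.

(* K_{la,mu}(q,t) *)
Definition macdonald_K (la mu : seq nat) : Qtq := schur_coef (macdonald_H mu) la.

(* Value at a of a rational function with no pole at a. *)
Definition ratfun_eval (L : fieldType) (f : {fraction {poly L}}) (a : L) : L :=
  xget 0 [set v | exists u d : {poly L},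
    [/\ d.[a] != 0, f = FracField.tofrac u / FracField.tofrac d
      & v = u.[a] / d.[a]]]%classic.

(* K_{la,mu}(0,t) *)
Definition macdonald_K_q0 (la mu : seq nat) : Qt :=
  ratfun_eval (macdonald_K la mu) 0.

(* Main.v *)
(* For mu = (1^n) Garsia and Haiman's characterization forces H_mu[X(1-t)] to be
   a multiple of h_n, so H_mu = (t;t)_n h_n[X/(1-t)] does not depend on q.  By
   the Pieri rule, both this function and the sum over standard tableaux T of
   t^(sum of n - d over the descents d of T) s_(sh T) expand as a sum over
   compositions alpha of n of products of the h_(alpha_i); the two expansions
   agree after reversing the compositions.

   On the other side, a core lambda^(i) of degree i <= n is just a partition of
   i, so an ABC of n-weight (1^n) is a standard tableau T: the letter i records
   the box (r, c) added to lambda^(i-1).  In the chain from lambda^(i) to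
   (n + lambda^(i-1)_1, lambda^(i-1)) the bottom row grows one cell at a time,
   except that for r > 0 it skips the length n + 1 + c - r, which would create a
   hook of length n + 1.  This skip is the only domino of the letter i, so i + 1
   contributes to the spin exactly when i is a descent of T. *)

Require Import Defs.
From mathcomp Require Import all_boot all_order all_algebra fraction.
From mathcomp Require Import mpoly.
From mathcomp Require Import boolp classical_sets.
From mathcomp Require Import zify ring.

Set Implicit Arguments.
Unset Strict Implicit.
Unset Printing Implicit Defensive.

Import GRing.Theory.

(** * Jacobi-Trudi determinants and the Pieri rule *)

Local Open Scope ring_scope.

(** The delicate step is the reversal of compositions. Descent sums satisfy a recursion that cuts
    off the last part, a break after box c having the weight w_c/(1 - w_c). The identity X/(1-t) = X
    + tX/(1-t) gives h_m[X/(1-t)] a recursion that cuts off the first part. The two match because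
    w_d = t^(n-d) depends only on the number of boxes after d: what remains after the first part is
    the same problem in smaller degree. This is why descent sums are studied for weights shifted by
    an arbitrary s.

    On the side of arrays, the letter i has its domino in row n + 1 - i from the bottom, and the
    head lies in column n + 1 + c - r, which is n + 1 plus the content of box i. From one box of a
    standard tableau to the next, the content grows exactly when there is no descent, so comparing
    heads detects descents, and a descent d = i - 1 gets the weight n - d. *)

Lemma big_pick (R : nzRingType) (I : finType) (F : I -> R) (i : I) :
  \sum_k (k == i)%:R * F k = F i.
Proof.
rewrite (bigD1 i) //= eqxx mul1r big1 ?addr0 // => k /negPf ->.
by rewrite mul0r.
Qed.

Lemma big_pick_pred (R : nzRingType) N (F : nat -> R) i :
  \sum_(k < N) (k.+1 == i :> nat)%:R * F k = (if (0 < i <= N)%N then F i.-1 else 0).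
Proof.
case: i => [|i] /=; first by rewrite big1 // => k _; rewrite mul0r.
case: ltnP => iN; last first.
  rewrite big1 // => k _; rewrite eqSS; case: eqP => [ki|]; last by rewrite mul0r.
  by have := ltn_ord k; rewrite ki ltnNge iN.
rewrite (bigD1 (Ordinal iN)) //= eqxx mul1r big1 ?addr0 // => k.
by rewrite eqSS -val_eqE => /negPf /= ->; rewrite mul0r.
Qed.

Section JacobiTrudi.

Variable R : comNzRingType.

(* Row operations turn det (e (b_i + j)) into the left-hand side, whose expansion
   by rows is a sum over horizontal strips; column operations turn it into the
   right-hand side. *)
Lemma det_interlacing (N : nat) (hh e : nat -> R) (z : R) (b : nat -> nat) :
  (forall x, e x = hh x + z * e x.+1) ->
  (forall i, (i < N)%N -> (b i.+1 <= b i)%N) -> b N = 0%N ->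
  (forall x, (x < N)%N -> hh x = 0) ->
  \det (\matrix_(i < N.+1, j < N.+1)
     if i == 0%N :> nat then e (b 0 + j)%N
     else \sum_(d < b i.-1 - b i) z ^+ d * hh (b i + d + j)%N) =
  e N * \det (\matrix_(i < N, j < N) hh (b i + j)%N).
Proof.
move=> he hb bN hh0.
have he_sum m x : e x = \sum_(d < m) z ^+ d * hh (x + d)%N + z ^+ m * e (x + m)%N.
  elim: m => [|m IHm]; first by rewrite big_ord0 add0r expr0 mul1r addn0.
  rewrite big_ord_recr /= {1}IHm {1}[e (x + m)%N]he mulrDr addrA -addnS.
  by rewrite mulrA -exprSr.
pose E := \matrix_(i < N.+1, j < N.+1) e (b i + j)%N.
pose U := \matrix_(i < N.+1, k < N.+1)
  ((k == i)%:R - (k.+1 == i :> nat)%:R * z ^+ (b k - b i)).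
pose W := \matrix_(k < N.+1, j < N.+1)
  ((k == j)%:R - (k == j.+1 :> nat)%:R * z).
have UE i k : U i k = (k == i)%:R - (k.+1 == i :> nat)%:R * z ^+ (b k - b i) by rewrite mxE.
have EE i j : E i j = e (b i + j)%N by rewrite mxE.
have WE k j : W k j = (k == j)%:R - (k == j.+1 :> nat)%:R * z by rewrite mxE.
have detU : \det U = 1.
  rewrite det_trig; first by rewrite big1 // => i _; rewrite !mxE eqxx /= gtn_eqF // mul0r subr0.
  apply/is_trig_mxP => i j ij; rewrite mxE -val_eqE /= gtn_eqF // gtn_eqF ?mul0r ?subr0 //.
  exact: (leq_trans ij).
have detW : \det W = 1.
  rewrite det_trig; first by rewrite big1 // => i _; rewrite !mxE eqxx /= ltn_eqF // mul0r subr0.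
  apply/is_trig_mxP => i j ij; rewrite mxE -val_eqE /= ltn_eqF // ltn_eqF ?mul0r ?subr0 //.
  exact: (ltn_trans ij).
set M := (X in \det X = _).
have -> : M = U *m E.
  apply/matrixP => i j; rewrite !mxE.
  under [RHS]eq_bigr => k _ do rewrite UE EE mulrBl -mulrA.
  rewrite sumrB big_pick (@big_pick_pred _ _ (fun k => z ^+ (b k - b i) * e (b k + j)%N)).
  have -> : (i <= N.+1)%N by exact: ltnW.
  rewrite andbT lt0n; case: eqP => [->|/eqP i0] /=; first by rewrite subr0.
  have bi : (b i <= b i.-1)%N.
    by case: (nat_of_ord i) (ltn_ord i) i0 => //= i' Hi' _; apply: hb.
  rewrite (he_sum (b i.-1 - b i)%N (b i + j)%N).
  have -> : (b i + j + (b i.-1 - b i) = b i.-1 + j)%N by rewrite addnAC subnKC.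
  by rewrite addrK; apply: eq_bigr => d _; rewrite addnAC.
rewrite det_mulmx detU mul1r -[LHS]mulr1 -detW -det_mulmx.
rewrite (expand_det_row _ ord_max) (bigD1 ord_max) //= big1 ?addr0; last first.
  move=> j jN; rewrite !mxE.
  have jN' : (j < N)%N by rewrite ltn_neqAle -ltnS ltn_ord andbT; move: jN; rewrite -val_eqE.
  under eq_bigr => k _ do rewrite EE WE mulrC mulrBl -mulrA.
  rewrite sumrB big_pick.
  have -> : \sum_(i < N.+1) (i == j.+1 :> nat)%:R * (z * e (b N + i)%N) = z * e j.+1.
    rewrite (bigD1 (Ordinal (jN' : j.+1 < N.+1)%N)) //= eqxx mul1r big1 ?addr0 ?bN //.
    by move=> k; rewrite -val_eqE => /negPf /= ->; rewrite mul0r.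
  by rewrite /= bN add0n {1}he addrK hh0 // mul0r.
congr (_ * _).
  rewrite !mxE; under eq_bigr => k _ do rewrite EE WE mulrC mulrBl -mulrA.
  rewrite sumrB big_pick bN big1 ?subr0 // => k _.
  by rewrite ltn_eqF // mul0r.
rewrite /cofactor /= -signr_odd oddD addbb expr0 mul1r; congr (\det _).
apply/matrixP => i j; rewrite !mxE.
have ei : fintype.lift ord_max i = i :> nat by rewrite /= /bump leqNgt ltn_ord.
have ej : fintype.lift ord_max j = j :> nat by rewrite /= /bump leqNgt ltn_ord.
under eq_bigr => k _ do rewrite EE WE mulrC mulrBl -mulrA.
rewrite sumrB big_pick ei ej.
have -> : \sum_(k < N.+1) (k == j.+1 :> nat)%:R * (z * e (b i + k)%N) = z * e (b i + j).+1.
  rewrite (bigD1 (Ordinal (ltn_ord j : j.+1 < N.+1)%N)) //= eqxx mul1r big1 ?addr0 ?addnS //.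
  by move=> k; rewrite -val_eqE => /negPf /= ->; rewrite mul0r.
by rewrite he addrK.
Qed.

Lemma det_row_sum (n : nat) (J : finType) (a : 'I_n -> J -> R)
    (m : 'I_n -> J -> 'I_n -> R) :
  \det (\matrix_(i, j) \sum_d a i d * m i d j) =
  \sum_(D : {ffun 'I_n -> J}) (\prod_i a i (D i)) * \det (\matrix_(i, j) m i (D i) j).
Proof.
rewrite /determinant.
under eq_bigr => s _.
  under eq_bigr => i _ do rewrite mxE.
  rewrite bigA_distr_bigA /= mulr_sumr.
  under eq_bigr => D _ do rewrite big_split /= mulrCA.
  over.
rewrite exchange_big /=; apply: eq_bigr => D _.
rewrite mulr_sumr; apply: eq_bigr => s _.
by congr (_ * (_ * _)); apply: eq_bigr => i _; rewrite mxE.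
Qed.

(** The size [L] may exceed the number of nonzero values of [f], so that all shapes in a Pieri sum
    share one matrix size; [jt_widen] removes the surplus. *)
Definition jt (L : nat) (h : nat -> R) (f : nat -> nat) : R :=
  \det (\matrix_(i < L, j < L)
    if (i <= f i + j)%N then h (f i + j - i)%N else 0).

Lemma eq_jt L h f g : (forall i, (i < L)%N -> f i = g i) -> jt L h f = jt L h g.
Proof.
by move=> fg; congr (\det _); apply/matrixP => i j; rewrite !mxE fg.
Qed.

Lemma jt_last (L : nat) (h : nat -> R) (f : nat -> nat) :
  h 0 = 1 -> f L = 0%N -> jt L.+1 h f = jt L h f.
Proof.
move=> h0 fL; rewrite /jt (expand_det_row _ ord_max) (bigD1 ord_max) //= big1 ?addr0.
  rewrite !mxE /= fL add0n leqnn subnn h0 mul1r.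
  rewrite /cofactor /= -signr_odd oddD addbb expr0 mul1r; congr (\det _).
  apply/matrixP => i j; rewrite !mxE /= /bump.
  by rewrite ![(L <= _)%N]leqNgt !ltn_ord.
move=> j jL; rewrite !mxE /= fL add0n leqNgt ltn_neqAle -ltnS ltn_ord andbT.
by rewrite -val_eqE in jL; rewrite jL mul0r.
Qed.

Lemma jt_widen (L M : nat) (h : nat -> R) (f : nat -> nat) :
  h 0 = 1 -> (L <= M)%N -> (forall i, (L <= i)%N -> f i = 0%N) ->
  jt M h f = jt L h f.
Proof.
move=> h0 /subnK <- f0; elim: (M - L)%N => [//|d IHd].
by rewrite addSn jt_last ?IHd // f0 // leq_addl.
Qed.

End JacobiTrudi.

Section Pieri.

Variable R : comNzRingType.
Implicit Types (h : nat -> R) (f : nat -> nat).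

(** The variable of [{poly R}] marks added boxes: with z = 'X in [det_interlacing], the factor [e N]
    is the generating polynomial of [h], and the coefficient of 'X^k selects the strips with k
    boxes. The vanishing of [h] at large arguments makes this series a polynomial. *)
Lemma pieri_ffun_trunc h f (N B k : nat) :
  (forall i, (f i.+1 <= f i)%N) -> f N = 0%N -> (N + f 0 < B)%N ->
  (forall x, (B <= N + x)%N -> h x = 0) ->
  h k * jt N h f =
  \sum_(D : {ffun 'I_N.+1 -> 'I_B} |
      (\sum_i D i == k)%N && [forall i : 'I_N.+1, (0 < i)%N ==> (D i <= f i.-1 - f i)%N])
    jt N.+1 h (fun i => f i + D (inord i))%N.
Proof.
move=> fdec fN fB hB.
(* Beta numbers: entry (i, j) of the Jacobi-Trudi matrix is [hh (b i + j)], the shift by [N] turning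
   h_m = 0 for m < 0 into [hh x = 0] for x < N. *)
pose hh x := if (N <= x)%N then h (x - N)%N else 0.
pose b i := (f i + (N - i))%N.
pose e x : {poly R} := \sum_(d < B) 'X^d * (hh (x + d)%N)%:P.
have hhB x : (B <= x)%N -> hh x = 0.
  move=> Bx; rewrite /hh; case: leqP => // Nx.
  by rewrite hB // subnKC.
have he x : e x = (hh x)%:P + 'X * e x.+1.
  rewrite /e; have /prednK <- : (0 < B)%N by apply: leq_ltn_trans fB.
  have {}hhB y : (B.-1 < y)%N -> hh y = 0 by move=> By; apply: hhB; lia.
  set m := B.-1 in hhB *.
  rewrite big_ord_recl expr0 mul1r addn0; congr (_ + _).
  rewrite [in RHS]big_ord_recr /= [hh (x.+1 + m)%N]hhB; last by rewrite addSn ltnS leq_addl.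
  rewrite polyC0 mulr0 addr0 mulr_sumr; apply: eq_bigr => d _.
  by rewrite mulrA -exprS addSnnS.
have bdec i : (i < N)%N -> (b i.+1 <= b i)%N.
  by move=> iN; rewrite /b leq_add // leq_sub2l.
have bN : b N = 0%N by rewrite /b fN subnn.
have hh0 x : (x < N)%N -> (hh x)%:P = 0 :> {poly R}.
  by move=> xN; rewrite /hh leqNgt xN.
have := det_interlacing he bdec bN hh0.
have bfE (i : nat) g m : (i <= N)%N ->
    hh (g + (N - i) + m)%N = if (i <= g + m)%N then h (g + m - i)%N else 0.
  move=> iN; rewrite /hh; have -> : (N <= g + (N - i) + m)%N = (i <= g + m)%N by lia.
  by case: ifP => // _; congr h; lia.
move=> /(congr1 (fun p : {poly R} => p`_k)).
have -> : \det (\matrix_(i < N, j < N) (hh (b i + j)%N)%:P) = (jt N h f)%:P :> {poly R}.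
  rewrite -det_map_mx; congr (\det _); apply/matrixP => i j; rewrite !mxE /b bfE //.
  exact: ltnW.
rewrite coefMC.
have -> : (e N)`_k = h k.
  rewrite /e coef_sum.
  under eq_bigr => d _ do rewrite coefMC coefXn mulrC mulr_natr.
  case: (ltnP k B) => kB.
    rewrite (bigD1 (Ordinal kB)) //= eqxx mulr1n big1 ?addr0.
      by rewrite /hh leq_addr addKn.
    by move=> d; rewrite -val_eqE eq_sym => /negPf /= ->; rewrite mulr0n.
  rewrite big1 ?hB // => [|d _]; first exact: leq_trans kB (leq_addl _ _).
  by rewrite gtn_eqF ?mulr0n // (leq_trans _ kB).
move=> <-.
have f_le0 i : (f i <= f 0)%N.
  by elim: i => // i IHi; apply: leq_trans (fdec i) IHi.
pose c (i : 'I_N.+1) (d : nat) := (0 < i)%N ==> (d <= f i.-1 - f i)%N.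
transitivity (\det (\matrix_(i < N.+1, j < N.+1)
    \sum_(d < B) ((c i d)%:R * 'X^d) * (hh (b i + d + j)%N)%:P))`_k.
  apply: (congr1 (fun p : {poly R} => p`_k)); congr (\det _); apply/matrixP => i j; rewrite !mxE /c.
  case: (posnP i) => [i0|i_gt0] /=.
    rewrite i0 /e /=; apply: eq_bigr => d _.
    by rewrite mul1r addnAC.
  (* The staircase in [b] adds one to the gap, so that d may reach [f i.-1 - f i]: the horizontal
     strip condition. *)
  have -> : (b i.-1 - b i = (f i.-1 - f i).+1)%N.
    by have := fdec i.-1; rewrite prednK // /b; have := ltn_ord i; lia.
  rewrite (big_ord_widen B (fun d => 'X^d * (hh (b i + d + j)%N)%:P)).
    rewrite big_mkcond /=; apply: eq_bigr => d _.
    by rewrite ltnS; case: ifP => _; rewrite ?mul1r ?mul0r.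
  by have := f_le0 i.-1; lia.
rewrite det_row_sum coef_sum [RHS]big_mkcond /=; apply: eq_bigr => D _.
have -> : \det (\matrix_(i < N.+1, j < N.+1) (hh (b i + D i + j)%N)%:P) =
    (jt N.+1 h (fun i => f i + D (inord i))%N)%:P :> {poly R}.
  rewrite -det_map_mx; congr (\det _); apply/matrixP => i j; rewrite !mxE inord_val.
  by rewrite /b [(f i + _ + _)%N]addnAC bfE // -ltnS.
rewrite coefMC big_split /= prodrXr.
case: (boolP [forall i : 'I_N.+1, _]) => [/forallP cD|/forallPn [i cD]].
  rewrite big1 => [|i _]; last by rewrite /c cD.
  by rewrite mul1r coefXn andbT eq_sym; case: eqP => _; rewrite ?mul1r ?mul0r.
rewrite andbF (bigD1 i) //= /c (negPf cD) !mul0r coef0 mul0r.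
by [].
Qed.

End Pieri.

(** * Standard tableaux as words *)

Local Open Scope nat_scope.

Lemma geq_trans : transitive geq.
Proof. by move=> y x z yx /leq_trans; apply. Qed.

Lemma geq_anti : antisymmetric geq.
Proof. by move=> x y; rewrite andbC => /anti_leq. Qed.

Fixpoint words (L m : nat) : seq (seq nat) :=
  if m is m'.+1 then [seq rcons u r | u <- words L m', r <- iota 0 L]
  else [:: [::]].

Lemma mem_words L m u :
  (u \in words L m) = (size u == m) && all (fun r => r < L) u.
Proof.
elim: m u => [|m IHm] u; first by rewrite inE; case: u.
apply/allpairsP/idP => [[[v r] /= [+ + ->]]|].
  by rewrite IHm mem_iota size_rcons all_rcons eqSS => /andP [-> ->] /andP [_ ->].
case/lastP: u => [|v r]; first by rewrite andFb.
rewrite size_rcons all_rcons eqSS => /and3P [sv rL vL].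
by exists (v, r); rewrite /= IHm mem_iota sv vL.
Qed.

Lemma uniq_words L m : uniq (words L m).
Proof.
elim: m => // m IHm; apply: allpairs_uniq; rewrite ?iota_uniq //.
by move=> [u r] [v s] _ _ /= /rcons_inj [-> ->].
Qed.

(* Letter r at position l puts the (l+1)-st box of a standard tableau in row r,
   so that yam words are the standard tableaux. *)
Definition yam (u : seq nat) : bool :=
  all (fun i => let r := nth 0 u i in
        (r == 0) || (count_mem r (take i u) < count_mem r.-1 (take i u)))
      (iota 0 (size u)).

Lemma yam_rcons u r :
  yam (rcons u r) =
  yam u && ((r == 0) || (count_mem r u < count_mem r.-1 u)).
Proof.
rewrite /yam size_rcons -addn1 iotaD all_cat /= andbT add0n.
rewrite nth_rcons ltnn eqxx -cats1 take_size_cat //; congr (_ && _).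
apply: eq_in_all => i; rewrite mem_iota => /andP [_ iu].
by rewrite nth_cat iu take_cat iu.
Qed.

Lemma yam_catl u v : yam (u ++ v) -> yam u.
Proof.
elim/last_ind: v => [|v r IHv]; first by rewrite cats0.
by rewrite -rcons_cat yam_rcons => /andP [/IHv].
Qed.

Lemma yam_take m u : yam u -> yam (take m u).
Proof. by rewrite -{1}(cat_take_drop m u) => /yam_catl. Qed.

Lemma yam_count u r : yam u -> count_mem r.+1 u <= count_mem r u.
Proof.
elim/last_ind: u => // u s IHu; rewrite yam_rcons => /andP [/IHu{}IHu].
rewrite -cats1 !count_cat /= !addn0.
have [->|/=] := eqVneq s r.+1; first by rewrite /= gtn_eqF // addn1 addn0.
by move=> _ _; rewrite addn0 (leq_trans IHu) // leq_addr.
Qed.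

Lemma yam_count_le u r s : yam u -> r <= s -> count_mem s u <= count_mem r u.
Proof.
move=> yu /subnK <-; elim: (s - r) => // d; apply: leq_trans.
exact: yam_count.
Qed.

Lemma yam_lt_size u r : yam u -> r \in u -> r < size u.
Proof.
elim/last_ind: u r => // u s IHu r; rewrite yam_rcons mem_rcons inE size_rcons.
move=> /andP [yu su] /predU1P [->|/(IHu _ yu)/leqW//].
case: s su => //= s su; rewrite ltnS; apply: IHu => //.
by rewrite -has_pred1 has_count (leq_ltn_trans _ su).
Qed.

Lemma yam_count0 u r : yam u -> size u <= r -> count_mem r u = 0.
Proof.
move=> yu ur; apply/count_memPn/negP => /(yam_lt_size yu).
by rewrite ltnNge ur.
Qed.

Lemma yam_words L u : yam u -> size u <= L -> u \in words L (size u).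
Proof.
move=> yu uL; rewrite mem_words eqxx; apply/allP => r ru.
exact: leq_trans (yam_lt_size yu ru) uL.
Qed.

(** In a weakly decreasing [v] all letters r come before any r - 1, so row r - 1 keeps its length in
    [u] while row r grows: [v] adds a horizontal strip, box by box from left to right. *)
Lemma yam_cat_sorted u v : yam u -> sorted geq v ->
  yam (u ++ v) =
  all (fun r => count_mem r v <= count_mem r.-1 u - count_mem r u)
      [seq r <- v | 0 < r].
Proof.
move=> yu; elim/last_ind: v => [|v r IHv]; first by rewrite cats0 yu.
move=> srt; have /IHv {}IHv : sorted geq v.
  by move: srt; rewrite !(sorted_pairwise geq_trans) -cats1 pairwise_cat => /and3P [].
have v_ge x : x \in v -> r <= x.
  move: srt; rewrite (sorted_pairwise geq_trans) -cats1 pairwise_cat.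
  by move=> /and3P [/allrelP H _ _] xv; apply: H; rewrite ?inE.
rewrite -rcons_cat yam_rcons IHv.
have r1 : 0 < r -> count_mem r.-1 v = 0.
  by move=> r_gt0; apply/count_memPn/negP => /v_ge; rewrite leqNgt prednK ?leqnn.
rewrite !count_cat.
apply/andP/allP => [[/allP H Hr] x|H].
  rewrite mem_filter mem_rcons inE -cats1 count_cat /= addn0 => /andP [x0].
  case: (eqVneq x r) => [xr _|xr /= xv].
    subst x; move: Hr; rewrite (gtn_eqF x0) (r1 x0) addn0 /= addn1; lia.
  by rewrite addn0; apply: H; rewrite mem_filter x0.
split.
  apply/allP => x; rewrite mem_filter => /andP [x0 xv].
  have := H x; rewrite mem_filter x0 mem_rcons inE xv orbT => /(_ isT).
  by rewrite -cats1 count_cat; apply: leq_trans; rewrite leq_addr.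
case: (posnP r) => //= r_gt0.
have := H r; rewrite mem_filter r_gt0 mem_rcons inE eqxx => /(_ isT).
rewrite -cats1 count_cat /= eqxx (r1 r_gt0); lia.
Qed.

Local Open Scope ring_scope.

(** The length of row [r] in the shape of the tableau coded by [u]. *)
Definition mult (u : seq nat) (r : nat) : nat := count_mem r u.

Section PieriWords.

Variables (N B k : nat) (u : seq nat).
Hypotheses (yam_u : yam u) (uN : (size u <= N)%N) (kB : (k < B)%N).

Let profile (v : seq nat) : {ffun 'I_N.+1 -> 'I_B} :=
  [ffun i : 'I_N.+1 => insubd (Ordinal kB) (count_mem (i : nat) v)].

Let profileE v (i : 'I_N.+1) : size v = k -> profile v i = count_mem (i : nat) v :> nat.
Proof.
move=> vk; rewrite ffunE val_insubd ifT // (leq_ltn_trans _ kB) // -vk.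
exact: count_size.
Qed.

(** A weakly decreasing word is determined by its letter counts, so the strips [D] of the
    determinant expansion correspond to the suffixes [v]. *)
Lemma perm_pieri_profile :
  perm_eq [seq D : {ffun 'I_N.+1 -> 'I_B} <- index_enum {ffun 'I_N.+1 -> 'I_B} |
             (\sum_i D i == k)%N &&
             [forall i : 'I_N.+1, (0 < i)%N ==> (D i <= mult u i.-1 - mult u i)%N]]
          [seq profile v | v <- [seq v <- words N.+1 k | yam (u ++ v) && sorted geq v]].
Proof.
have sum_mult v : all (fun r => r < N.+1)%N v -> (\sum_(i < N.+1) count_mem (i : nat) v)%N = size v.
  elim: v => [_|x v IHv /= /andP [xN /IHv <-]]; first by rewrite big1.
  rewrite big_split /= (bigD1 (Ordinal xN)) //= eqxx big1 // => i.
  by rewrite -val_eqE eq_sym => /negPf /= ->.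
apply: uniq_perm.
- by rewrite filter_uniq // index_enum_uniq.
- rewrite map_inj_in_uniq ?filter_uniq ?uniq_words // => v w.
  rewrite !mem_filter !mem_words => /and3P [/andP [_ sv] /eqP vk vN].
  move=> /and3P [/andP [_ sw] /eqP wk wN] vw.
  apply: (sorted_eq geq_trans geq_anti) => //.
  apply/allP => x; rewrite mem_cat => xvw; apply/eqP.
  have xN : (x < N.+1)%N by case/orP: xvw; [move/(allP vN)|move/(allP wN)].
  have := congr1 (fun D : {ffun 'I_N.+1 -> 'I_B} => D (Ordinal xN) : nat) vw.
  by rewrite !profileE.
move=> D; rewrite mem_filter mem_index_enum andbT.
apply/idP/mapP => [/andP [/eqP Dk /forallP DN]|[v]]; last first.
  rewrite mem_filter mem_words => /and3P [/andP [yv sv] /eqP vk vN] ->.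
  apply/andP; split.
    by rewrite -[X in _ == X]vk -(sum_mult v vN); apply/eqP/eq_bigr => i _; rewrite profileE.
  apply/forallP => i; apply/implyP => i0; rewrite profileE // /mult.
  move: yv; rewrite yam_cat_sorted // => /allP H.
  case: (boolP (nat_of_ord i \in v)) => iv; first by apply: H; rewrite mem_filter i0.
  by rewrite (count_memPn iv).
pose v := sort geq (flatten [seq nseq (D i) (nat_of_ord i) | i <- enum 'I_N.+1]).
have cv (i : 'I_N.+1) : count_mem (i : nat) v = D i.
  rewrite /v count_sort count_flatten -map_comp sumnE big_map big_enum /=.
  rewrite (bigD1 i) //= count_nseq /= eqxx mul1n big1 ?addn0 // => j.
  by rewrite -val_eqE count_nseq /= => /negPf ->.
have vN : all (fun r => r < N.+1)%N v.
  rewrite /v all_sort; apply/allP => x /flattenP [s /mapP [i _ ->]].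
  by rewrite mem_nseq => /andP [_ /eqP ->].
have vk : size v = k.
  by rewrite -(sum_mult v vN) -Dk; apply: eq_bigr => i _; rewrite cv.
have sv : sorted geq v by apply: sort_sorted => x y; apply: leq_total.
exists v.
  rewrite mem_filter mem_words vk eqxx vN sv !andbT yam_cat_sorted //.
  apply/allP => r; rewrite mem_filter => /andP [r0 /(allP vN) rN].
  by have := DN (Ordinal rN); rewrite /= r0 (cv (Ordinal rN)).
by apply/ffunP => i; apply/val_inj; apply: etrans (esym (cv i)) (esym (profileE i vk)).
Qed.

Lemma pieri_words_trunc (R : comNzRingType) (h : nat -> R) :
  h 0 = 1 -> (N + size u < B)%N -> (forall x, (B <= N + x)%N -> h x = 0) ->
  h k * jt N.+1 h (mult u) =
  \sum_(v <- words N.+1 k | yam (u ++ v) && sorted geq v) jt N.+1 h (mult (u ++ v)).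
Proof.
move=> h0 uB hB; rewrite jt_last //; last by rewrite /mult yam_count0.
rewrite (@pieri_ffun_trunc _ _ _ _ B) //; first last.
- by apply: leq_ltn_trans uB; rewrite leq_add2l count_size.
- by rewrite /mult yam_count0.
- by move=> i; apply: yam_count.
rewrite -big_filter (perm_big _ perm_pieri_profile) big_map -[RHS]big_filter /=.
rewrite big_seq [RHS]big_seq; apply: eq_bigr => v.
rewrite mem_filter mem_words => /and3P [_ /eqP vk _].
apply: eq_jt => i iN; rewrite profileE // inordK // /mult count_cat //.
Qed.

End PieriWords.

Lemma pieri_words (R : comNzRingType) (h : nat -> R) (L k : nat) (u : seq nat) :
  h 0 = 1 -> yam u -> (size u < L)%N ->
  h k * jt L h (mult u) =
  \sum_(v <- words L k | yam (u ++ v) && sorted geq v) jt L h (mult (u ++ v)).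
Proof.
case: L => [//|N] h0 yu uN.
(* All arguments of [h] in these determinants are at most k + size u + N, where [h] and its
   truncation [h'] agree. *)
pose B := (k + size u + N + N).+1; pose h' x := if (N + x < B)%N then h x else 0.
have jt_h' w : (size w <= k + size u)%N -> jt N.+1 h (mult w) = jt N.+1 h' (mult w).
  move=> wk; congr (\det _); apply/matrixP => i j; rewrite !mxE /h'.
  case: ifP => // _; rewrite ifT //.
  have : (mult w i <= size w)%N := count_size _ _.
  by have := ltn_ord j; rewrite /B; lia.
rewrite jt_h' ?leq_addl //.
have -> : h k = h' k by rewrite /h' ifT // /B; lia.
rewrite (@pieri_words_trunc N B) //.
- rewrite big_seq_cond [RHS]big_seq_cond; apply: eq_bigr => v /andP [vk _].
  rewrite jt_h' // size_cat addnC leq_add2r.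
  by move: vk; rewrite mem_words => /andP [/eqP ->].
- by rewrite /B; lia.
- by rewrite /h' ifT // /B; lia.
- by rewrite /B; lia.
- by move=> x xB; rewrite /h' ltnNge xB.
Qed.

(** * Descent generating functions of standard tableaux *)

Arguments words : simpl never.

Lemma big_words0 (V : nmodType) (L : nat) (F : seq nat -> V) :
  \sum_(u <- words L 0) F u = F [::].
Proof. by rewrite big_seq1. Qed.

Lemma big_words_rcons (V : nmodType) (L m : nat) (F : seq nat -> V) :
  \sum_(u <- words L m.+1) F u =
  \sum_(u <- words L m) \sum_(r <- iota 0 L) F (rcons u r).
Proof. by rewrite big_allpairs_dep. Qed.

Lemma big_words_cons (V : nmodType) (L m : nat) (F : seq nat -> V) :
  \sum_(u <- words L m.+1) F u =
  \sum_(a <- iota 0 L) \sum_(v <- words L m) F (a :: v).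
Proof.
elim: m F => [|m IHm] F.
  by rewrite big_words_rcons big_words0; apply: eq_bigr => a _; rewrite big_words0.
rewrite big_words_rcons IHm; apply: eq_bigr => a _.
by rewrite big_words_rcons.
Qed.

Section DescentWeights.

Variables (R : comNzRingType) (h : nat -> R) (L : nat).
Hypothesis h0 : h 0 = 1.
Implicit Types (w : nat -> R) (u v : seq nat).

(* l is a descent of the standard tableau coded by u when box l+1 lies in a
   higher row than box l; 1-based boxes, 0-based letters. *)
Definition desc_wt w u : R :=
  \prod_(1 <= d < size u) (if (nth 0 u d.-1 < nth 0 u d)%N then w d else 1).

Lemma desc_wt_rcons w u r :
  desc_wt w (rcons u r) =
  desc_wt w u * (if (0 < size u)%N && (last 0%N u < r)%N then w (size u) else 1).
Proof.
rewrite /desc_wt size_rcons; case: (posnP (size u)) => [u0|u_gt0].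
  by rewrite u0 big_geq // big_geq // mul1r.
rewrite big_nat_recr //= !nth_rcons ltnn eqxx prednK // leqnn nth_last.
congr (_ * _); apply: eq_big_nat => d /andP [d0 du].
by rewrite !nth_rcons du (leq_ltn_trans (leq_pred d) du).
Qed.

(** A weakly decreasing suffix has no descents, so only its junction with [rcons u a] can
    contribute. *)
Lemma desc_wt_cat w u a b v : sorted geq (b :: v) ->
  desc_wt w (rcons u a ++ b :: v) =
  desc_wt w (rcons u a) * (if (a < b)%N then w (size u).+1 else 1).
Proof.
elim/last_ind: v => [|v c IHv] srt.
  by rewrite cats1 [LHS]desc_wt_rcons size_rcons last_rcons.
have [srtv cv] : sorted geq (b :: v) /\ (c <= last b v)%N.
  by move: srt; rewrite /= rcons_path => /andP [].
rewrite -rcons_cons -rcons_cat desc_wt_rcons IHv // last_cat /=.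
by rewrite [(_ < c)%N]ltnNge cv andbF mulr1.
Qed.

(** For [h = hsym] the determinant is a Schur function, and this is the weighted sum over standard
    tableaux with [m] boxes. *)
Definition desc_sum w m : R :=
  \sum_(u <- words L m | yam u) desc_wt w u * jt L h (mult u).

Lemma desc_sum0 w : desc_sum w 0 = 1.
Proof.
rewrite /desc_sum big_mkcond big_words0 /= /desc_wt big_geq // mul1r.
by rewrite (@jt_widen _ 0) // /jt det_mx00.
Qed.

(** The last [j] boxes contain no descent. [Z] weights the junction of [u] and [v]; [X] leaves it
    unweighted, so that its sum over [v] is a Pieri product. *)
Let Z w i j : R :=
  \sum_(u <- words L i) \sum_(v <- words L j | yam (u ++ v) && sorted geq v)
    desc_wt w (u ++ v) * jt L h (mult (u ++ v)).

Let X w i j : R :=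
  \sum_(u <- words L i) \sum_(v <- words L j | yam (u ++ v) && sorted geq v)
    desc_wt w u * jt L h (mult (u ++ v)).

Let X_pieri w i j : (i < L)%N -> X w i j = h j * desc_sum w i.
Proof.
move=> iN; rewrite /X /desc_sum [in RHS]big_mkcond mulr_sumr.
rewrite big_seq [RHS]big_seq; apply: eq_bigr => u.
rewrite mem_words => /andP [/eqP ui _].
rewrite -mulr_sumr; case: ifP => [yu|nyu].
  by rewrite mulrCA pieri_words // ui.
rewrite mulr0 big1 ?mulr0 // => v /andP [/yam_catl].
by rewrite nyu.
Qed.

Let Z0 w j : (0 < L)%N -> Z w 0 j = h j.
Proof.
move=> L0; transitivity (X w 0 j).
  rewrite /Z /X !big_words0; apply: eq_bigr => v /andP [_ sv]; congr (_ * _).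
  rewrite /desc_wt [RHS]big_geq // big_nat big1 // => d /andP [d0 dv].
  case: d d0 dv => // d _ dv.
  by move/sortedP: sv => /(_ 0%N d dv); rewrite /= leqNgt => /negPf ->.
by rewrite X_pieri // desc_sum0 mulr1.
Qed.

(* In the words of Z (i+1) j, position i+1 is a descent or the descent-free
   suffix extends one step to the left. *)
Let ZS w i j : (0 < j)%N ->
  Z w i.+1 j = w i.+1 * X w i.+1 j + (1 - w i.+1) * Z w i j.+1.
Proof.
move=> j0; rewrite /Z /X !big_words_rcons !mulr_sumr -big_split.
rewrite big_seq [RHS]big_seq; apply: eq_bigr => u.
rewrite mem_words => /andP [/eqP ui _].
rewrite [X in (1 - _) * X]big_mkcond big_words_cons.
rewrite !mulr_sumr -big_split /=; apply: eq_bigr => a _.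
rewrite [in LHS]big_mkcond [X in w i.+1 * X]big_mkcond !mulr_sumr -big_split.
rewrite big_seq [RHS]big_seq; apply: eq_bigr => v.
rewrite mem_words => /andP [/eqP vj _].
case: v vj => [|b v] vj; first by rewrite -vj in j0.
rewrite cat_rcons; case yv: (yam _); last by rewrite /= !mulr0 addr0.
rewrite -cat_rcons; case sv: (sorted _ _); last first.
  by move: sv => /= ->; rewrite andbF !mulr0 addr0.
rewrite desc_wt_cat //= ui; move: sv => /= ->; rewrite andbT.
by case: (ltnP a b) => _ /=; ring.
Qed.

Lemma desc_sumS w m : desc_sum w m.+1 = Z w m 1.
Proof.
rewrite /desc_sum /Z [LHS]big_mkcond big_words_rcons; apply: eq_bigr => u _.
rewrite [RHS]big_mkcond big_words_rcons big_words0; apply: eq_bigr => r _ /=.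
by rewrite cats1 andbT.
Qed.

(** [ri d] stands for the inverse of [1 - w d]: the normalization clears the factors [1 - w] of
    [ZS], and only the ratios w_c/(1 - w_c) survive. *)
Definition desc_nsum (w ri : nat -> R) (m : nat) : R :=
  desc_sum w m * \prod_(1 <= d < m) ri d.

(** This unrolls [ZS]: c is the last position at which the term [X] is taken, and m - c is the last
    part of a composition. *)
Lemma desc_nsum_rec (w ri : nat -> R) (m : nat) : (0 < m <= L)%N ->
  (forall d, (0 < d < m)%N -> (1 - w d) * ri d = 1) ->
  desc_nsum w ri m =
  h m + \sum_(1 <= c < m) w c * ri c * desc_nsum w ri c * h (m - c)%N.
Proof.
case: m => // m mL hri; rewrite /desc_nsum desc_sumS.
have key i j : (i <= m)%N -> (0 < j)%N -> Z w i j * \prod_(1 <= d < i.+1) ri d =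
    h (i + j)%N + \sum_(1 <= c < i.+1) w c * ri c * desc_nsum w ri c * h (i.+1 + j - c.+1)%N.
  elim: i j => [|i IHi] j im j0.
    by rewrite !big_geq // Z0 ?mulr1 ?addr0 // (leq_ltn_trans (leq0n m) mL).
  rewrite ZS // X_pieri; last exact: leq_ltn_trans im mL.
  rewrite !(big_nat_recr i.+1) //= mulrDl.
  have := IHi j.+1 (ltnW im) isT; set P := \prod_(1 <= d < i.+1) ri d => IH.
  have hi := hri i.+1 im.
  rewrite [X in _ + X](_ : _ = (1 - w i.+1) * ri i.+1 * (Z w i j.+1 * P)); last by ring.
  rewrite hi mul1r IH addnS -addSn [in RHS]addrA [LHS]addrC; congr (_ + _ + _).
    apply: eq_big_nat => c /andP [c0 ci].
    by congr (_ * h _); lia.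
  rewrite /desc_nsum -/P addSn subSS addKn; ring.
rewrite key // addn1; congr (_ + _); apply: eq_big_nat => c /andP [c0 ci].
by rewrite addn1 subSS.
Qed.

End DescentWeights.

Lemma sum_triangle (V : nmodType) (F : nat -> nat -> V) (m : nat) :
  \sum_(1 <= i < m) \sum_(1 <= j < i) F i j =
  \sum_(1 <= j < m) \sum_(1 <= k < m - j) F (j + k)%N j.
Proof.
elim: m => [|m IHm]; first by rewrite !big_geq.
case: m IHm => [|m] IHm; first by rewrite !big_geq.
rewrite big_nat_recr //= IHm [in RHS]big_nat_recr //= subSnn [X in _ = _ + X]big_geq //.
rewrite addr0 -big_split /=; apply: eq_big_nat => j /andP [j0 jm].
by rewrite (subSn (ltnW jm)) big_nat_recr ?subn_gt0 //= subnKC // ltnW.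
Qed.

(* Both recursions sum the products h_(c_1) rho_(c_1) h_(c_2 - c_1) rho_(c_2) ...
   over all c_1 < c_2 < ..., cutting off the last or the first factor. *)
Lemma last_part_first_part (R : comNzRingType) (b : nat -> nat -> R)
    (h rho : nat -> R) (n : nat) :
  (forall s m, (0 < m)%N -> (s + m <= n)%N ->
     b s m = h m + \sum_(1 <= c < m) rho (s + c)%N * b s c * h (m - c)%N) ->
  forall s m, (0 < m)%N -> (s + m <= n)%N ->
    b s m = h m + \sum_(1 <= c < m) rho (s + c)%N * h c * b (s + c)%N (m - c)%N.
Proof.
move=> hb s m; have [k] := ubnP m; elim: k s m => // k IHk s m mk m0 smn.
rewrite hb //; congr (_ + _).
transitivity (\sum_(1 <= c < m) (rho (s + c)%N * h c * h (m - c)%N +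
    \sum_(1 <= e < c) rho (s + c)%N * (rho (s + e)%N * h e * b (s + e)%N (c - e)%N) * h (m - c)%N)).
  apply: eq_big_nat => c /andP [c0 cm]; rewrite (IHk s c) //; try lia.
  rewrite mulrDr mulrDl; congr (_ + _).
  by rewrite mulr_sumr mulr_suml.
rewrite big_split /= sum_triangle -big_split /=; apply: eq_big_nat => c /andP [c0 cm].
rewrite (hb (s + c)%N); [|lia..].
rewrite mulrDr; congr (_ + _); rewrite mulr_sumr.
apply: eq_big_nat => e /andP [e0 em].
by rewrite addKn addnA subnDA; ring.
Qed.

(** * Newton's identities *)

Definition newton (R : pzRingType) (p a : nat -> R) : Prop :=
  a 0 = 1 /\ forall m, a m *+ m = \sum_(1 <= i < m.+1) p i * a (m - i)%N.

(** For generating functions, [newton p a] says that z a'(z) = p(z) a(z), and the lemma is the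
    product rule. On symmetric functions it expands h_m[X + Y]. *)
Lemma newton_conv (R : comNzRingType) (p q a b : nat -> R) :
  newton p a -> newton q b ->
  newton (fun i => p i + q i) (fun m => \sum_(0 <= i < m.+1) a i * b (m - i)%N).
Proof.
move=> [a0 ha] [b0 hb]; split=> [|m]; first by rewrite big_nat1 a0 b0 mulr1.
have half (p' a' b' : nat -> R) :
    (forall m, a' m *+ m = \sum_(1 <= i < m.+1) p' i * a' (m - i)%N) ->
    \sum_(0 <= i < m.+1) (a' i *+ i) * b' (m - i)%N =
    \sum_(1 <= k < m.+1) p' k * \sum_(0 <= i < (m - k).+1) a' i * b' (m - k - i)%N.
  move=> ha'.
  transitivity (\sum_(1 <= i < m.+2) \sum_(1 <= k < i)
      p' k * a' (i.-1 - k)%N * b' (m - i.-1)%N).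
    rewrite [RHS]big_add1 /=; apply: eq_big_nat => i _.
    by rewrite ha' mulr_suml.
  rewrite sum_triangle big_nat_recr //= [X in _ + X]big_geq ?subSnn // addr0.
  apply: eq_big_nat => k /andP [k0 km].
  rewrite mulr_sumr subSn 1?ltnW // big_add1 /= subSn //.
  apply: eq_big_nat => i /andP [_ im].
  by rewrite addnS /= addKn -mulrA subnDA.
rewrite -sumrMnl.
(* The product rule: the factor m is split as i + (m - i). *)
transitivity (\sum_(0 <= i < m.+1) (a i *+ i) * b (m - i)%N +
              \sum_(0 <= i < m.+1) (b i *+ i) * a (m - i)%N).
  rewrite [X in _ + X]big_nat_rev /= add0n -big_split /=.
  apply: eq_big_nat => i /andP [_ im]; rewrite subSS subKn // mulrnAl mulrnAl.
  by rewrite [b _ * _]mulrC -mulrnDr subnKC.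
rewrite (half _ _ _ ha) (half _ _ _ hb) -big_split /=.
apply: eq_big_nat => k _; rewrite mulrDl; congr (_ + _ * _).
rewrite big_nat_rev /= add0n; apply: eq_big_nat => i /andP [_ im].
by rewrite subSS subKn // mulrC.
Qed.

Lemma newton_uniq (R : nzRingType) (p q a b : nat -> R) (n : nat) :
  (forall (x y : R) m, x *+ m.+1 = y *+ m.+1 -> x = y) ->
  (forall i, (0 < i <= n)%N -> p i = q i) ->
  newton p a -> newton q b -> forall m, (m <= n)%N -> a m = b m.
Proof.
move=> inj pq [a0 ha] [b0 hb] m; have [k] := ubnP m; elim: k m => // k IHk m mk mn.
case: m mk mn => [|m] mk mn; first by rewrite a0 b0.
apply: (inj _ _ m); rewrite ha hb; apply: eq_big_nat => i /andP [i0 im].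
by rewrite pq ?i0 //= 1?(leq_trans _ mn) // IHk //; lia.
Qed.

(** * Schur functions in the power sum ring *)

Section PowerSumRing.

Variables (F : fieldType) (n : nat).
Hypothesis char0 : forall m, m.+1%:R != 0 :> F.
Local Notation mp := {mpoly F[n]}.
Local Notation h := (hsym F n).
Local Notation p := (psum F n).

Lemma mpoly_mulrnI (f g : mp) m : f *+ m.+1 = g *+ m.+1 -> f = g.
Proof.
by rewrite -!scaler_nat => /(scalerI (char0 m)).
Qed.

Lemma size_hseq m : size (hseq F n m) = m.+1.
Proof. by elim: m => //= m IHm; rewrite size_rcons IHm. Qed.

Lemma nth_hseq m k : (k <= m)%N -> (hseq F n m)`_k = h k.
Proof.
elim: m => [|m IHm]; first by rewrite leqn0 => /eqP ->.
rewrite leq_eqVlt => /predU1P [-> //|km].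
by rewrite /= nth_rcons size_hseq km IHm.
Qed.

Lemma newton_hsym : newton p h.
Proof.
split=> // -[|m]; first by rewrite big_geq ?mulr0n.
rewrite {1}/hsym /= nth_rcons size_hseq ltnn eqxx -scaler_nat scalerA.
rewrite divff // scale1r; apply: eq_big_nat => i /andP [i0 im].
by rewrite nth_hseq //; lia.
Qed.

Lemma psum_ord (i : 'I_n) : p i.+1 = 'X_i.
Proof. by rewrite /psum /= valK. Qed.

(** Besides [pleth], this covers its inverse f[X/(1-t)], with a_m = 1/(1 - t^m). *)
Definition scale_psum (a : nat -> F) (f : mp) : mp :=
  f \mPo [tuple a i.+1 *: 'X_i | i < n].

Lemma scale_psumXU a (i : 'I_n) : scale_psum a 'X_i = a i.+1 *: 'X_i.
Proof. by rewrite /scale_psum comp_mpolyXU -tnth_nth tnth_mktuple. Qed.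

Lemma scale_psumE a i : (0 < i)%N -> scale_psum a (p i) = a i *: p i.
Proof.
case: i => // i _; rewrite /psum /=; case: insubP => [j _ <-|_].
  by rewrite scale_psumXU.
by rewrite /scale_psum comp_mpoly0 scaler0.
Qed.

Lemma newton_scale_psum a : newton (fun i => a i *: p i) (fun m => scale_psum a (h m)).
Proof.
have [h0 hS] := newton_hsym; split=> [|m]; first by rewrite h0 /scale_psum comp_mpoly1.
rewrite -[RHS](_ : scale_psum a (h m *+ m) = _); first by rewrite /scale_psum comp_mpolyMn.
rewrite hS /scale_psum raddf_sum /=; apply: eq_big_nat => i /andP [i0 im].
by rewrite rmorphM /= -/(scale_psum a (p i)) scale_psumE.
Qed.

Lemma scale_psum_comp a b f :
  scale_psum a (scale_psum b f) = scale_psum (fun i => b i * a i) f.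
Proof.
have sE c g : scale_psum c g = \sum_(m <- msupp g) g@_m *: scale_psum c 'X_[m].
  rewrite {1}(mpolyE g) /scale_psum raddf_sum /=.
  by apply: eq_bigr => m _; rewrite comp_mpolyZ.
rewrite (sE b) (sE _ f) {1}/scale_psum raddf_sum /=; apply: eq_bigr => m _.
rewrite comp_mpolyZ; congr (_ *: _); rewrite /scale_psum.
rewrite !comp_mpolyX rmorph_prod /=; apply: eq_bigr => i _.
rewrite rmorphXn /= !tnth_mktuple comp_mpolyZ -/(scale_psum a _) scale_psumXU.
by rewrite scalerA.
Qed.

Lemma scale_psum_id a f : (forall i, (0 < i <= n)%N -> a i = 1) -> scale_psum a f = f.
Proof.
move=> a1; rewrite -[RHS]comp_mpoly_id /scale_psum; congr (_ \mPo _).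
by apply: eq_mktuple => i; rewrite a1 ?scale1r //= ltn_ord.
Qed.

Lemma pleth_scale_psum a f : pleth a f = scale_psum (fun i => 1 - a ^+ i) f.
Proof. by []. Qed.

Definition schur_word (u : seq nat) : mp := jt n h (mult u).

(** The span of the Schur functions of degree [d], indexed redundantly by standard tableaux so that
    [pieri_words] applies directly. *)
Definition inspan (d : nat) (f : mp) : Prop :=
  exists c : seq nat -> F, f = \sum_(u <- words n d | yam u) c u *: schur_word u.

Lemma inspan_schur_word u : yam u -> (size u <= n)%N -> inspan (size u) (schur_word u).
Proof.
move=> yu un; exists (fun w => (w == u)%:R).
rewrite -big_filter (bigD1_seq u) ?filter_uniq ?uniq_words ?mem_filter ?yu ?yam_words //=.
by rewrite eqxx scale1r big1 ?addr0 // => w /negPf ->; rewrite scale0r.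
Qed.

Lemma inspanD d f g : inspan d f -> inspan d g -> inspan d (f + g).
Proof.
move=> [c ->] [c' ->]; exists (fun u => c u + c' u).
by rewrite -big_split; apply: eq_bigr => u _; rewrite scalerDl.
Qed.

Lemma inspanZ d a f : inspan d f -> inspan d (a *: f).
Proof.
move=> [c ->]; exists (fun u => a * c u).
by rewrite scaler_sumr; apply: eq_bigr => u _; rewrite scalerA.
Qed.

Lemma inspan_sum (I : eqType) d (r : seq I) (P : pred I) (f : I -> mp) :
  (forall i, i \in r -> P i -> inspan d (f i)) -> inspan d (\sum_(i <- r | P i) f i).
Proof.
move=> fd; rewrite big_seq_cond; elim/big_ind: _ => [|f1 f2|i /andP [ir /fd]]; last exact.
  by exists (fun=> 0); rewrite big1 // => u _; rewrite scale0r.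
exact: inspanD.
Qed.

Lemma inspan1 : inspan 0 1.
Proof.
exists (fun=> 1); rewrite big_mkcond big_words0 /= scale1r /schur_word.
by rewrite (@jt_widen _ 0) // /jt det_mx00.
Qed.

Lemma inspan_hmul d j f : (d < n)%N -> (d + j <= n)%N -> inspan d f ->
  inspan (d + j) (h j * f).
Proof.
move=> dn djn [c ->]; rewrite mulr_sumr; apply: inspan_sum => u.
rewrite mem_words => /andP [/eqP ud _] yu; rewrite -scalerAr; apply: inspanZ.
rewrite pieri_words ?ud //; apply: inspan_sum => v.
rewrite mem_words => /andP [/eqP vj _] /andP [yuv _].
by have := inspan_schur_word yuv; rewrite size_cat ud vj; apply.
Qed.

(** Newton's identity writes p_m through h_m and the products p_i h_(m-i) with i < m, and
    multiplication by h is the Pieri rule. *)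
Lemma inspan_pmul d m f : (0 < m)%N -> (d + m <= n)%N -> inspan d f ->
  inspan (d + m) (p m * f).
Proof.
have [k] := ubnP m; elim: k d m f => // k IHk d m f mk m0 dmn df.
have -> : p m * f = m%:R *: (h m * f) - \sum_(1 <= i < m) p i * (h (m - i)%N * f).
  have [h0 /(_ m)] := newton_hsym; rewrite big_nat_recr //= subnn h0 mulr1.
  rewrite scaler_nat -mulrnAl => ->; rewrite mulrDl mulr_suml.
  rewrite [X in X - _](_ : _ = \sum_(1 <= i < m) p i * (h (m - i)%N * f) + p m * f).
    by rewrite addrC addKr.
  by congr (_ + _); apply: eq_bigr => i _; rewrite mulrA.
apply: inspanD; first by apply/inspanZ/inspan_hmul => //; lia.
rewrite -scaleN1r; apply: inspanZ.
apply: inspan_sum => i; rewrite mem_index_iota => /andP [i0 im] _.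
have -> : (d + m = d + (m - i) + i)%N by lia.
apply: IHk => //; try lia.
by apply: inspan_hmul => //; lia.
Qed.

(** The scaled h_m obey Newton's identities for the scaled power sums, so [inspan_pmul] and division
    by m give the induction. *)
Lemma inspan_scale_psum a m : (m <= n)%N -> inspan m (scale_psum a (h m)).
Proof.
have [q0 qS] := newton_scale_psum a.
have [k] := ubnP m; elim: k m => // k IHk [|m] mk mn; first by rewrite q0; exact: inspan1.
suff: inspan m.+1 (m.+1%:R *: scale_psum a (h m.+1)).
  by move/(inspanZ m.+1%:R^-1); rewrite scalerA mulVf // scale1r.
rewrite scaler_nat qS; apply: inspan_sum => i.
rewrite mem_index_iota => /andP [i0 im] _; rewrite -scalerAl; apply: inspanZ.
have {1}-> : (m.+1 = m.+1 - i + i)%N by rewrite subnK.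
by apply: inspan_pmul => //; [lia | apply: IHk; lia].
Qed.

Definition psum_prod (mu : seq nat) : mp := \prod_(x <- mu) p x.

Lemma inspan_psum_prod mu : 0%N \notin mu -> (sumn mu <= n)%N ->
  inspan (sumn mu) (psum_prod mu).
Proof.
rewrite /psum_prod; elim: mu => [|x mu IHmu] /=; first by rewrite big_nil => _ _; exact: inspan1.
rewrite inE negb_or eq_sym -lt0n => /andP [x0 mu0] mun.
by rewrite big_cons addnC; apply: inspan_pmul => //; [lia | apply: IHmu => //; lia].
Qed.

Definition part_mnm (mu : seq nat) : 'X_{1..n} := [multinom count_mem i.+1 mu | i < n].

Lemma psum_prodE mu : all (fun x => 0 < x <= n)%N mu -> psum_prod mu = 'X_[part_mnm mu].
Proof.
rewrite /psum_prod; elim: mu => [_|[//|x] mu IHmu /= /andP [xn /IHmu IH]].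
  by rewrite big_nil -mpolyX0; congr 'X_[_]; apply/mnmP => i; rewrite !mnmE.
rewrite big_cons IH (psum_ord (Ordinal xn)) -mpolyXD; congr 'X_[_].
by apply/mnmP => i; rewrite !mnmE /= eqSS -val_eqE.
Qed.

End PowerSumRing.

Definition word_shape (u : seq nat) : seq nat := [seq q <- mkseq (mult u) (size u) | 0 < q]%N.

(** The zeros of a weakly decreasing sequence are at its end, where [nth] returns 0 by default. *)
Lemma nth_pos_filter (s : seq nat) i : sorted geq s ->
  nth 0%N [seq q <- s | 0 < q]%N i = nth 0%N s i.
Proof.
elim: s i => //= x s IHs i xs; have /IHs{}IHs := path_sorted xs.
case: posnP => [x0|_] /=; last by case: i.
have s0 : all (eq_op 0%N) s.
  have := order_path_min geq_trans xs; apply: sub_all => y /=.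
  by rewrite x0 leqn0 eq_sym.
have /all_pred1P s_nseq : all (pred1 0%N) s.
  by apply: sub_all s0 => y /=; rewrite eq_sym.
have nth_s j : nth 0%N s j = 0%N by rewrite s_nseq nth_nseq if_same.
by rewrite IHs x0; case: i => [|i] /=; rewrite !nth_s.
Qed.

Lemma is_part_filter (s : seq nat) : sorted geq s -> is_part [seq q <- s | 0 < q]%N.
Proof.
move=> srt; rewrite /is_part (sorted_filter geq_trans) //=.
by rewrite mem_filter.
Qed.

Lemma sumn_pos_filter (s : seq nat) : sumn [seq q <- s | 0 < q]%N = sumn s.
Proof. by elim: s => //= x s IHs; case: posnP => [->|_] /=; rewrite IHs. Qed.

Lemma sorted_mult u m : yam u -> sorted geq (mkseq (mult u) m).
Proof.
move=> yu; apply/(sortedP 0%N) => i; rewrite size_mkseq => im.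
rewrite !nth_mkseq ?(ltnW im) //; exact: yam_count.
Qed.

Lemma sum_mult u m : all (fun r => r < m)%N u -> sumn (mkseq (mult u) m) = size u.
Proof.
rewrite sumnE big_map; have -> : iota 0 m = index_iota 0 m by rewrite /index_iota subn0.
rewrite big_mkord /mult.
elim: u => [_|x u IHu /= /andP [xm /IHu <-]]; first by rewrite big1.
rewrite big_split /= (bigD1 (Ordinal xm)) //= eqxx big1 // => i.
by rewrite -val_eqE eq_sym => /negPf /= ->.
Qed.

Lemma nth_shape u r : yam u -> nth 0%N (word_shape u) r = mult u r.
Proof.
move=> yu; rewrite nth_pos_filter ?sorted_mult //.
case: (ltnP r (size u)) => ru; first by rewrite nth_mkseq.
by rewrite nth_default ?size_mkseq // /mult yam_count0.
Qed.

Lemma size_shape u : (size (word_shape u) <= size u)%N.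
Proof. by rewrite size_filter (leq_trans (count_size _ _)) // size_mkseq. Qed.

Lemma is_part_shape u : yam u -> is_part (word_shape u).
Proof. by move=> yu; apply/is_part_filter/sorted_mult. Qed.

Lemma sumn_shape u : yam u -> sumn (word_shape u) = size u.
Proof.
move=> yu; rewrite sumn_pos_filter sum_mult //; apply/allP => r.
exact: yam_lt_size.
Qed.

Lemma eq_part (la mu : seq nat) : is_part la -> is_part mu ->
  (forall i, nth 0%N la i = nth 0%N mu i) -> la = mu.
Proof.
move=> /andP [_ la0] /andP [_ mu0] eq_i; apply: (@eq_from_nth _ 0%N) => //.
have le_size s t : 0%N \notin s -> (forall i, nth 0%N s i = nth 0%N t i) -> (size s <= size t)%N.
  move=> s0 st; rewrite leqNgt; apply/negP => ts.
  by case/negP: s0; rewrite -[X in X \in _](nth_default 0%N (leqnn (size t))) -st mem_nth.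
by apply/eqP; rewrite eqn_leq !le_size // => i; rewrite eq_i.
Qed.

Definition parts (n : nat) : seq (seq nat) :=
  [seq part_val s | s <- enum [pred s : n.-bseq 'I_n.+1 | is_part_of n (part_val s)]].

Lemma part_val_inj n : injective (@part_val n).
Proof.
move=> s t /(inj_map val_inj) st; exact: val_inj.
Qed.

Lemma uniq_parts n : uniq (parts n).
Proof. by rewrite map_inj_uniq ?enum_uniq //; exact: part_val_inj. Qed.

Lemma is_part_of_bound n la : is_part_of n la ->
  (size la <= n)%N && all (fun x => 0 < x <= n)%N la.
Proof.
move=> /andP [/andP [_ la0] /eqP <-]; elim: la la0 => //= x la IHla.
rewrite inE negb_or eq_sym -lt0n => /andP [x0 /IHla /andP [sla /allP lan]].
rewrite x0 leq_addr -addn1 addnC leq_add //=; apply/allP => y /lan /andP [-> ylan].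
exact: leq_trans ylan (leq_addl _ _).
Qed.

Lemma mem_parts n la : (la \in parts n) = is_part_of n la.
Proof.
apply/mapP/idP => [[s + ->]|lan]; first by rewrite mem_enum.
have /andP [sla /allP lan'] := is_part_of_bound lan.
have sz : (size [seq inord x : 'I_n.+1 | x <- la] <= n)%N by rewrite size_map.
have E : la = part_val (Bseq sz).
  rewrite /part_val /= -map_comp -[LHS]map_id; apply/eq_in_map => x /lan' /andP [_ xn] /=.
  by rewrite inordK.
by exists (Bseq sz); rewrite // mem_enum inE -E.
Qed.

Lemma schur_combE (F : fieldType) n (P : pred (seq nat)) (c : seq nat -> F) :
  schur_comb n P c = \sum_(la <- parts n | P la) c la *: schur F n la.
Proof.
rewrite /parts big_map /schur_comb big_enum_cond /=.
by apply: eq_bigl => s; rewrite inE.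
Qed.

(** * The modified Macdonald polynomial of a column *)

Section SchurBasis.

Variables (F : fieldType) (n : nat).
Hypothesis char0 : forall m, m.+1%:R != 0 :> F.
Local Notation mp := {mpoly F[n]}.
Local Notation h := (hsym F n).

Lemma schur_shape u : yam u -> (size u <= n)%N ->
  schur F n (word_shape u) = schur_word F n u.
Proof.
move=> yu un; transitivity (jt (size (word_shape u)) h (nth 0%N (word_shape u))); first by [].
transitivity (jt n h (nth 0%N (word_shape u))).
  apply/esym/jt_widen => [//||i]; last exact: nth_default.
  exact: leq_trans (size_shape u) un.
by apply: eq_jt => i _; rewrite nth_shape.
Qed.

Lemma sum_words_parts (c : seq nat -> F) :
  \sum_(u <- words n n | yam u) c u *: schur_word F n u =
  \sum_(la <- parts n)
     (\sum_(u <- words n n | yam u && (word_shape u == la)) c u) *: schur F n la.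
Proof.
under [RHS]eq_bigr => la _ do rewrite scaler_suml big_mkcondr.
rewrite exchange_big /= big_seq_cond [RHS]big_seq_cond; apply: eq_bigr => u.
rewrite mem_words => /andP [/andP [/eqP un _] yu].
rewrite (bigD1_seq (word_shape u)) ?uniq_parts //=; last first.
  by rewrite mem_parts /is_part_of is_part_shape //= sumn_shape ?un.
rewrite eqxx big1 ?addr0; first by rewrite schur_shape ?un.
by move=> la; rewrite eq_sym => /negPf ->.
Qed.

Lemma inspan_parts f : inspan n f ->
  exists c, f = \sum_(la <- parts n) c la *: schur F n la.
Proof. by move=> [c ->]; eexists; exact: sum_words_parts. Qed.

Lemma part_mnm_inj la mu : is_part_of n la -> is_part_of n mu ->
  part_mnm n la = part_mnm n mu -> la = mu.
Proof.
move=> lan mun /mnmP eq_i.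
have /andP [/andP [sla _] _] := lan; have /andP [/andP [smu _] _] := mun.
have /andP [_ /allP lan'] := is_part_of_bound lan.
have /andP [_ /allP mun'] := is_part_of_bound mun.
apply: (sorted_eq geq_trans geq_anti) => //.
apply/allP => x; rewrite mem_cat => xin; apply/eqP.
have /andP [x0 xn] : (0 < x <= n)%N by case/orP: xin => [/lan'|/mun'].
case: x x0 xn {xin} => // x _ xn.
by have := eq_i (Ordinal xn); rewrite !mnmE.
Qed.

(* The matrix expressing power sum products in Schur functions is a left
   inverse of the square matrix of power sum coefficients of Schur functions. *)
Lemma schur_free (c c' : seq nat -> F) :
  \sum_(la <- parts n) c la *: schur F n la =
  \sum_(la <- parts n) c' la *: schur F n la ->
  {in parts n, c =1 c'}.
Proof.
move=> cc'; pose K := size (parts n); pose P (i : 'I_K) := nth [::] (parts n) i.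
have PK i : is_part_of n (P i) by rewrite -mem_parts mem_nth.
have sumK (G : seq nat -> mp) : \sum_(la <- parts n) G la = \sum_(i < K) G (P i).
  by rewrite (big_nth [::]) big_mkord.
pose S := \matrix_(i < K, j < K) (schur F n (P i))@_(part_mnm n (P j)).
have P_span i : exists d, psum_prod F n (P i) = \sum_(la <- parts n) d la *: schur F n la.
  apply: inspan_parts; have /andP [/andP [_ P0] /eqP Pn] := PK i.
  by have := inspan_psum_prod char0 P0 (_ : (sumn (P i) <= n)%N); rewrite Pn; apply.
have [N HN] := choice P_span.
have NS : (\matrix_(i < K, j < K) N i (P j)) *m S = 1%:M.
  apply/matrixP => i j; rewrite !mxE.
  transitivity ((psum_prod F n (P i))@_(part_mnm n (P j))).
    by rewrite HN sumK raddf_sum; apply: eq_bigr => k _; rewrite !mxE /= mcoeffZ.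
  have /andP [_ Pi] := is_part_of_bound (PK i).
  (* A product of power sums is a single monomial here, and distinct partitions give distinct
     monomials, whence the identity matrix. *)
  rewrite psum_prodE // mcoeffX; congr (nat_of_bool _)%:R.
  apply/eqP/eqP => [E|-> //]; apply/val_inj/eqP.
  rewrite -(nth_uniq [::] (ltn_ord i) (ltn_ord j) (uniq_parts n)); apply/eqP.
  exact: part_mnm_inj (PK i) (PK j) E.
have SN := mulmx1C NS.
pose r (d : seq nat -> F) := \row_(i < K) d (P i).
have rS d : r d *m S = \row_j (\sum_(la <- parts n) d la *: schur F n la)@_(part_mnm n (P j)).
  apply/rowP => j; rewrite !mxE sumK raddf_sum /=; apply: eq_bigr => k _.
  by rewrite !mxE mcoeffZ.
have rr : r c = r c' by rewrite -[r c]mulmx1 -[r c']mulmx1 -SN !mulmxA !rS cc'.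
move=> la lan; have laK : (index la (parts n) < K)%N by rewrite index_mem.
by have /rowP /(_ (Ordinal laK)) := rr; rewrite !mxE /P nth_index.
Qed.

Lemma schur_coef_comb (c : seq nat -> F) la : is_part_of n la ->
  schur_coef (schur_comb n xpredT c) la = c la.
Proof.
move=> lan; rewrite /schur_coef; case: xgetP => [x _ [c' + <-]|/(_ (c la)) []].
  by rewrite !schur_combE => /schur_free -> //; rewrite mem_parts.
by exists c.
Qed.

Variable t : F.
Hypothesis t_generic : forall m, 1 - t ^+ m.+1 != 0.

Let g (m : nat) : mp := scale_psum (fun i => (1 - t ^+ i)^-1) (h m).

(** Since X/(1-t) = X + tX/(1-t), [newton_conv] expands g_m as the sum of t^(m-c) h_c g_(m-c). The
    term c = 0 is t^m g_m and moves to the left. *)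
Let g_rec m : (0 < m)%N ->
  (1 - t ^+ m) *: g m = \sum_(1 <= c < m.+1) t ^+ (m - c) *: (h c * g (m - c)%N).
Proof.
move=> m0; have [g0 gS] : newton _ g := @newton_scale_psum F n char0 _.
have tg : newton (fun i => (t ^+ i * (1 - t ^+ i)^-1) *: psum F n i) (fun m => t ^+ m *: g m).
  split=> [|k]; first by rewrite g0 scale1r.
  rewrite scalerMnr gS scaler_sumr; apply: eq_big_nat => i /andP [i0 ik].
  rewrite -!scalerAl -scalerAr !scalerA; congr (_ *: _).
  by rewrite mulrAC -exprD subnKC.
have hg := newton_conv (@newton_hsym F n char0) tg.
have pq i : (0 < i <= m)%N -> (1 - t ^+ i)^-1 *: psum F n i =
    psum F n i + (t ^+ i * (1 - t ^+ i)^-1) *: psum F n i.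
  case: i => // i _; rewrite -{2}[psum F n i.+1]scale1r -scalerDl; congr (_ *: _).
  apply: (mulIf (t_generic i)); rewrite mulrDl mul1r mulVf // -mulrA mulVf // mulr1.
  by rewrite subrK.
have E := newton_uniq (@mpoly_mulrnI F n char0) pq (conj g0 gS) hg (leqnn m).
rewrite scalerBl scale1r {1}E big_nat_recl // subn0.
have [h0 _] := @newton_hsym F n char0.
rewrite h0 mul1r addrC addKr [RHS]big_add1.
by apply: eq_big_nat => i _; rewrite scalerAr.
Qed.

Let w (d : nat) : mp := (t ^+ (n - d))%:MP.
Let ri (d : nat) : mp := ((1 - t ^+ (n - d))^-1)%:MP.

Let w_ri d : (d < n)%N -> (1 - w d) * ri d = 1.
Proof.
move=> dn; rewrite /w /ri -mpolyC1 -mpolyCB -mpolyCM mulfV //.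
by rewrite -(@subnSK d n).
Qed.

Lemma desc_sum_specialization : (0 < n)%N ->
  desc_sum h n w n =
  (\prod_(1 <= d < n.+1) (1 - t ^+ d)) *: scale_psum (fun i => (1 - t ^+ i)^-1) (h n).
Proof.
move=> n0; have [h0 _] := @newton_hsym F n char0.
(* The weights are shifted by [s], so [b s m] concerns the positions from s to s + m of a
   composition of n. *)
pose b s m := desc_nsum h n (fun d => w (s + d)%N) (fun d => ri (s + d)%N) m.
have b_last s m : (0 < m)%N -> (s + m <= n)%N -> b s m =
    h m + \sum_(1 <= c < m) (w (s + c)%N * ri (s + c)%N) * b s c * h (m - c)%N.
  move=> m0 smn; rewrite /b desc_nsum_rec //; first by rewrite m0 (leq_trans _ smn) ?leq_addl.
  by move=> d /andP [d0 dm]; apply: w_ri; lia.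
have b_first := last_part_first_part (rho := fun x => w x * ri x) b_last.
(* With s + m = n, the break at s + c has the weight t^(m-c)/(1 - t^(m-c)). Its denominator cancels
   the factor 1 - t^(m-c) of the induction hypothesis, and the recursion becomes [g_rec]. *)
have bE s m : (0 < m)%N -> (s + m = n)%N -> b s m = (1 - t ^+ m) *: g m.
  have [k] := ubnP m; elim: k s m => // k IHk s m mk m0 smn.
  rewrite b_first ?smn // g_rec // big_nat_recr //= subnn expr0 scale1r.
  have [g0 _] : newton _ g := @newton_scale_psum F n char0 _.
  rewrite g0 mulr1 addrC; congr (_ + _); apply: eq_big_nat => c /andP [c0 cm].
  rewrite (IHk (s + c)%N); [|lia..].
  rewrite /w /ri -mpolyCM !mul_mpolyC -!scalerAl -scalerAr scalerA; congr (_ *: _).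
  have -> : (n - (s + c) = m - c)%N by lia.
  have /prednK <- : (0 < m - c)%N by lia.
  by rewrite -mulrA mulVf ?mulr1.
have : desc_nsum h n w ri n = (1 - t ^+ n) *: g n := bE 0%N n n0 (add0n n).
have prodw : \prod_(1 <= d < n) (1 - w d) = (\prod_(1 <= d < n) (1 - t ^+ d))%:MP :> mp.
  rewrite rmorph_prod big_nat_rev /=; apply: eq_big_nat => d /andP [d0 dn].
  by rewrite /w -mpolyC1 -mpolyCB; congr (1 - t ^+ _)%:MP; lia.
(* This undoes the normalization of [desc_nsum]: the factors [1 - w d] cancel the [ri d] and, by
   [prodw], supply the remaining factors 1 - t^d. *)
move/(congr1 (fun f => f * \prod_(1 <= d < n) (1 - w d))).
rewrite /desc_nsum -mulrA -big_split /= big_nat big1 ?mulr1 => [->|d /andP [_ dn]]; last first.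
  by rewrite mulrC w_ri.
rewrite prodw mulrC mul_mpolyC scalerA; congr (_ *: _).
by rewrite big_nat_recr.
Qed.

Definition desc_coef (la : seq nat) : F :=
  \sum_(u <- words n n | yam u && (word_shape u == la)) desc_wt (fun d => t ^+ (n - d)) u.

Definition column_macdonald : mp :=
  schur_comb n xpredT desc_coef.

Lemma column_macdonaldE : (0 < n)%N ->
  column_macdonald =
  (\prod_(1 <= d < n.+1) (1 - t ^+ d)) *: scale_psum (fun i => (1 - t ^+ i)^-1) (h n).
Proof.
move=> n0; rewrite -desc_sum_specialization // /column_macdonald schur_combE.
rewrite -sum_words_parts /desc_sum; apply: eq_bigr => u _.
rewrite -mul_mpolyC; congr (_ * _); rewrite /desc_wt rmorph_prod /=.
by apply: eq_bigr => d _; case: ifP => _; rewrite ?mpolyC1.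
Qed.

Lemma desc_coef_row : (0 < n)%N -> desc_coef [:: n] = 1.
Proof.
move=> n0; rewrite /desc_coef big_seq_cond.
have yam0 : yam (nseq n 0%N).
  by apply/allP => i _; rewrite nth_nseq if_same.
have shape0 : word_shape (nseq n 0%N) = [:: n].
  apply: eq_part; first exact: is_part_shape.
    by rewrite /is_part /= inE eq_sym -lt0n n0.
  move=> i; rewrite nth_shape // /mult count_nseq /=.
  by case: i => [|i]; rewrite ?mul1n ?mul0n //= nth_nil.
rewrite (eq_bigl (pred1 (nseq n 0%N))) => [|u].
  rewrite -big_filter filter_pred1_uniq ?uniq_words //; last first.
    by have := yam_words yam0 (_ : (size _ <= n)%N); rewrite size_nseq; apply.
  rewrite big_seq1 /desc_wt big1 // => d _.
  by rewrite !nth_nseq !if_same.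
apply/idP/eqP => [|->]; last first.
  rewrite yam0 shape0 eqxx !andbT.
  by have := yam_words yam0 (_ : (size _ <= n)%N); rewrite size_nseq; apply.
rewrite mem_words => /and3P [/andP [/eqP un _] yu /eqP su].
have := nth_shape 0 yu; rewrite su /= /mult -{1}un => u0.
have /all_pred1P : all (pred1 0%N) u by rewrite all_count -u0.
by rewrite un.
Qed.

Lemma schur_row : (0 < n)%N -> schur F n [:: n] = h n.
Proof. by move=> n0; rewrite /schur det_mx11 mxE /= addn0 subn0. Qed.

Lemma one_row_parts : (0 < n)%N ->
  [seq la <- parts n | dominates la [:: n]] = [:: [:: n]].
Proof.
move=> n0.
have row_part : [:: n] \in parts n.
  by rewrite mem_parts /is_part_of /is_part /= addn0 inE eq_sym -lt0n n0 eqxx.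
rewrite -(filter_pred1_uniq (uniq_parts n) row_part); apply: eq_in_filter => la.
rewrite mem_parts => lan; rewrite /dominates /= addn0 !andbT.
apply/idP/eqP => [|->]; last by rewrite /= addn0.
have /andP [/andP [_ la0] /eqP lan'] := lan.
case: la la0 lan' {lan} => [|x la] /=; first by rewrite leqn0 => _ _ /eqP n0'; rewrite n0' in n0.
rewrite take0 /= addn0 inE negb_or => /andP [_ la0] <-.
rewrite -{2}[x]addn0 leq_add2l; case: la la0 => [|y la]; first by rewrite addn0.
by rewrite inE negb_or eq_sym -lt0n leqn0 addn_eq0 => /andP [/lt0n_neq0/negPf ->].
Qed.

End SchurBasis.

Lemma leq_size_sumn s : 0%N \notin s -> (size s <= sumn s)%N.
Proof.
elim: s => //= x s IHs; rewrite inE negb_or eq_sym -lt0n => /andP [x0 /IHs].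
by move=> ss; rewrite -add1n leq_add.
Qed.

Lemma dominates_column m la : is_part_of m la -> dominates la (nseq m 1%N).
Proof.
move=> /andP [/andP [_ la0] /eqP lam]; apply/allP => k.
rewrite mem_iota size_nseq add0n ltnS => /andP [_ km].
rewrite take_nseq // sumn_nseq mul1n; case: (leqP k (size la)) => kla; last first.
  by rewrite (take_oversize (ltnW kla)) lam.
rewrite -{1}(size_takel kla); apply: leq_size_sumn.
by apply: contra la0 => /mem_take.
Qed.

Lemma conj_part_column m : (0 < m)%N -> conj_part (nseq m 1%N) = [:: m].
Proof. by case: m => // m _; rewrite /conj_part /= /mkseq /= count_nseq mul1n add1n. Qed.

Section ColumnMacdonald.

Variables (F : fieldType) (q t : F).
Hypothesis char0 : forall m, m.+1%:R != 0 :> F.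
Hypothesis t_generic : forall m, 1 - t ^+ m.+1 != 0.

(** All partitions of n dominate (1^n), so the first condition asks for some Schur expansion, which
    [inspan_scale_psum] provides; the other two determine [H]. The equation for [mu] is a hypothesis
    because the type of [H] depends on [sumn mu], which is not convertible to [m]. *)
Lemma is_modified_macdonald_column (mu : seq nat) (m : nat)
    (H : {mpoly F[sumn mu]}) : (0 < m)%N -> mu = nseq m 1%N ->
  is_modified_macdonald q t H <-> H = column_macdonald (sumn mu) t.
Proof.
move=> m0 mu1; have nE : sumn mu = m by rewrite mu1 sumn_nseq mul1n.
rewrite /is_modified_macdonald; set n := sumn mu in H nE *.
have n0 : (0 < n)%N by rewrite nE.
have domE : [seq la <- parts n | dominates la mu] = parts n.
  apply/all_filterP/allP => la; rewrite mem_parts mu1 => lan.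
  by apply: dominates_column; rewrite -nE.
have conjE : conj_part mu = [:: n] by rewrite mu1 conj_part_column ?nE.
pose C : F := \prod_(1 <= d < n.+1) (1 - t ^+ d).
have C0 : C != 0.
  rewrite /C big_seq; elim/big_ind: _ => [||d]; first exact: oner_neq0.
    exact: mulf_neq0.
  by rewrite mem_index_iota; case: d.
pose g := scale_psum (fun i => (1 - t ^+ i)^-1) (hsym F n n).
have colE : column_macdonald n t = C *: g by apply: column_macdonaldE.
have scaleZ a c (f : {mpoly F[n]}) : scale_psum a (c *: f) = c *: scale_psum a f.
  exact: comp_mpolyZ.
have rowE c : schur_comb n (dominates^~ [:: n]) c = c [:: n] *: hsym F n n.
  by rewrite schur_combE -big_filter one_row_parts // big_seq1 schur_row.
have row1 : nseq (0 < n)%N n = [:: n] by rewrite n0.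
rewrite row1 conjE; split=> [[_ [c Ht] [d Hd d1]]|->].
  (* The plethysm X/(1-t) undoes that of the second condition. *)
  have Hg : H = c [:: n] *: g.
    rewrite /g -scaleZ -rowE -Ht pleth_scale_psum scale_psum_comp scale_psum_id //.
    by move=> [|i] // _; rewrite divff.
  have Hcol : H = (c [:: n] / C) *: column_macdonald n t.
    by rewrite colE scalerA divfK.
  have /schur_free E : \sum_(la <- parts n) d la *: schur F n la =
      \sum_(la <- parts n) (c [:: n] / C * desc_coef n t la) *: schur F n la.
    rewrite -(schur_combE n xpredT d) -Hd Hcol /column_macdonald schur_combE scaler_sumr.
    by apply: eq_bigr => la _; rewrite scalerA.
  (* The coefficient of s_(n), equal to 1 in both [H] and [column_macdonald], fixes the scalar. *)
  have := E char0 [:: n]; rewrite d1 desc_coef_row // mulr1 => E1.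
  rewrite Hcol -E1 ?scale1r // mem_parts.
  by rewrite /is_part_of /is_part /= addn0 inE eq_sym -lt0n n0 eqxx.
split.
- have [c Ec] : exists c,
      pleth q (column_macdonald n t) = \sum_(la <- parts n) c la *: schur F n la.
    apply: inspan_parts; rewrite pleth_scale_psum colE scaleZ scale_psum_comp.
    exact/inspanZ/inspan_scale_psum.
  by exists c; rewrite schur_combE -big_filter domE.
- exists (fun=> C); rewrite rowE pleth_scale_psum colE scaleZ scale_psum_comp.
  by rewrite scale_psum_id // => -[|i] // _; rewrite mulVf.
by exists (desc_coef n t) => //; apply: desc_coef_row.
Qed.

End ColumnMacdonald.

Lemma tofrac_char0 (L : fieldType) : (forall m, m.+1%:R != 0 :> L) ->
  forall m, m.+1%:R != 0 :> {fraction {poly L}}.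
Proof.
move=> L0 m; rewrite -(rmorph_nat (@FracField.tofrac {poly L})) tofrac_eq0.
by rewrite -polyC_natr polyC_eq0.
Qed.

Lemma Qt_char0 m : m.+1%:R != 0 :> Qt.
Proof. by apply: tofrac_char0 => k; rewrite Num.Theory.pnatr_eq0. Qed.

Lemma t_Qt_generic m : 1 - t_Qt ^+ m.+1 != 0.
Proof.
rewrite /t_Qt -rmorphXn -[1](rmorph1 (@FracField.tofrac {poly rat})) -rmorphB.
rewrite tofrac_eq0; apply/eqP => /(congr1 (fun p : {poly rat} => p`_0)).
by rewrite coefB coef1 coefXn subr0 coef0.
Qed.

Lemma t_Qtq_generic m : 1 - t_Qtq ^+ m.+1 != 0.
Proof.
rewrite /t_Qtq -rmorphXn -[1](rmorph1 (@FracField.tofrac {poly Qt})) -rmorphB.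
by rewrite tofrac_eq0 -polyC_exp -polyC1 -polyCB polyC_eq0 t_Qt_generic.
Qed.

Lemma ratfun_eval_const (L : fieldType) (c a : L) :
  ratfun_eval (FracField.tofrac (c%:P : {poly L})) a = c.
Proof.
rewrite /ratfun_eval; case: xgetP => [v _ [u [d [da +->]]]|/(_ c) []].
  have d0 : FracField.tofrac d != 0.
    by rewrite tofrac_eq0; apply: contraNneq da => ->; rewrite horner0.
  move=> E; have /eqP : FracField.tofrac (c%:P * d) = FracField.tofrac u.
    by rewrite rmorphM /= E divfK.
  rewrite tofrac_eq => /eqP <-.
  by rewrite hornerM hornerC mulfK.
exists c%:P, 1; split; first by rewrite hornerC oner_neq0.
  by rewrite rmorph1 divr1.
by rewrite !hornerC divr1.
Qed.

Lemma macdonald_K_q0_column (n : nat) (la : seq nat) : (0 < n)%N -> is_part_of n la ->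
  macdonald_K_q0 la (nseq n 1%N) = desc_coef n t_Qt la.
Proof.
move=> n0 lan; rewrite /macdonald_K_q0 /macdonald_K.
have char0 : forall m, m.+1%:R != 0 :> Qtq := tofrac_char0 Qt_char0.
have nE : sumn (nseq n 1%N) = n by rewrite sumn_nseq mul1n.
have iff_col H := is_modified_macdonald_column q_Qtq char0 t_Qtq_generic H n0 erefl.
have -> : macdonald_H (nseq n 1%N) = column_macdonald (sumn (nseq n 1%N)) t_Qtq.
  rewrite /macdonald_H; case: xgetP => [H _ /iff_col //|].
  by move=> /(_ (column_macdonald _ t_Qtq)) []; apply/iff_col.
rewrite schur_coef_comb ?nE //.
(* The coefficient is a constant polynomial in q, so its value at q = 0 is that constant. *)
rewrite -[RHS](ratfun_eval_const _ 0); congr ratfun_eval.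
rewrite /desc_coef !rmorph_sum /=; apply: eq_bigr => u _.
rewrite /desc_wt !rmorph_prod /=; apply: eq_bigr => d _.
case: ifP => _; first by rewrite [in RHS]polyC_exp [RHS]rmorphXn.
by rewrite polyC1 [RHS]rmorph1.
Qed.

(** * Cores and bottom strong strips *)

Local Open Scope nat_scope.

Definition col_len (la : seq nat) (j : nat) : nat := count (fun x => j < x) la.

Lemma nth_sorted_geq la i j : sorted geq la -> i <= j -> nth 0 la j <= nth 0 la i.
Proof.
move=> srt ij; case: (ltnP j (size la)) => jla; last by rewrite nth_default.
by apply: (sorted_leq_nth geq_trans (leqnn : reflexive geq)) => //; exact: leq_ltn_trans jla.
Qed.

Lemma lt_col la r j : sorted geq la -> (r < col_len la j) = (j < nth 0 la r).
Proof.
elim: la r => [|x la IHla] r srt; first by rewrite nth_nil.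
have le_x i : nth 0 (x :: la) i <= x := nth_sorted_geq srt (leq0n i).
rewrite /col_len /=; case: (ltnP j x) => [jx|xj].
  by case: r => [|r] /=; rewrite ?jx // add1n ltnS IHla // (path_sorted srt).
rewrite add0n -/(col_len la j) (IHla r (path_sorted srt)).
rewrite !ltnNge (leq_trans (le_x r) xj).
by rewrite (leq_trans (le_x r.+1) xj).
Qed.

Lemma eq_col la j x : sorted geq la ->
  (forall r, (r < x) = (j < nth 0 la r)) -> col_len la j = x.
Proof.
move=> srt H; apply/eqP; rewrite eqn_leq; apply/andP; split.
  by rewrite leqNgt lt_col // -H ltnn.
by rewrite leqNgt H -lt_col // ltnn.
Qed.

Lemma nth_conj_part la j : sorted geq la -> nth 0 (conj_part la) j = col_len la j.
Proof.
move=> srt; case: (ltnP j (head 0 la)) => jla; first by rewrite nth_mkseq.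
rewrite nth_default ?size_mkseq //; apply/esym/eq_col => // r.
rewrite ltn0 -nth0 in jla *; apply/esym/negbTE; rewrite -leqNgt.
exact: leq_trans (nth_sorted_geq srt (leq0n r)) jla.
Qed.

Lemma col_anti la i j : i <= j -> col_len la j <= col_len la i.
Proof. by move=> ij; apply: sub_count => x; apply: leq_ltn_trans. Qed.

Lemma hookE la r j : sorted geq la ->
  hook la (r, j) = (nth 0 la r - j.+1) + (col_len la j - r.+1) + 1.
Proof. by move=> srt; rewrite /hook /= nth_conj_part. Qed.

Lemma mem_cells la r j : ((r, j) \in cells la) = (j < nth 0 la r).
Proof.
apply/allpairsPdep/idP => [[x [y [_ + [-> ->]]]]|jr]; first by rewrite mem_iota.
exists r, j; rewrite !mem_iota /= jr; split=> //.
by rewrite ltnNge; apply: contraL jr => /(nth_default 0) ->.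
Qed.

Lemma uniq_cells la : uniq (cells la).
Proof.
apply: allpairs_uniq_dep; [exact: iota_uniq | by move=> *; exact: iota_uniq |].
by move=> [i j] [i' j'] _ _ /= [-> ->].
Qed.

Lemma mem_skew_cells la mu r j :
  ((r, j) \in skew_cells la mu) = (nth 0 mu r <= j < nth 0 la r).
Proof. by rewrite mem_filter !mem_cells -leqNgt. Qed.

Lemma includedP mu la : reflect (forall i, nth 0 mu i <= nth 0 la i) (included mu la).
Proof.
apply: (iffP allP) => H i; last by move=> _; apply: H.
case: (ltnP i (size mu)) => im; last by rewrite nth_default.
by apply: H; rewrite mem_iota.
Qed.

Lemma included_trans : transitive included.
Proof.
move=> y x z /includedP xy /includedP yz; apply/includedP => i.
exact: leq_trans (xy i) (yz i).
Qed.

Lemma uniq_map_inj (T U : eqType) (f : T -> U) s x y :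
  uniq (map f s) -> x \in s -> y \in s -> f x = f y -> x = y.
Proof.
elim: s => //= z s IHs /andP [zs us]; rewrite !inE.
move=> /predU1P [->|xs] /predU1P [->|ys] // fxy; last exact: IHs.
  by rewrite fxy map_f in zs.
by rewrite -fxy map_f in zs.
Qed.

Lemma horizontal_stripP la mu : sorted geq la -> sorted geq mu ->
  reflect ((forall i, nth 0 mu i <= nth 0 la i) /\ forall i, nth 0 la i.+1 <= nth 0 mu i)
          (horizontal_strip la mu).
Proof.
move=> sla smu; apply: (iffP andP) => [[/includedP inc un]|[inc H]]; split=> //.
- move=> i; rewrite leqNgt; apply/negP => mula.
  have c1 : (i, nth 0 mu i) \in skew_cells la mu.
    by rewrite mem_skew_cells leqnn (leq_trans mula) // nth_sorted_geq.
  have c2 : (i.+1, nth 0 mu i) \in skew_cells la mu.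
    by rewrite mem_skew_cells mula andbT nth_sorted_geq.
  by have [/eqP] := uniq_map_inj un c1 c2 erefl; rewrite ltn_eqF.
- exact/includedP.
rewrite map_inj_in_uniq ?filter_uniq ?uniq_cells // => -[r j] [r' j'].
rewrite !mem_skew_cells => /andP [h1 h2] /andP [h3 h4] /= jj'; rewrite -jj' in h3 h4 *.
have lt_false x y : x < y -> nth 0 mu x <= j -> j < nth 0 la y -> False.
  move=> xy mx ly; have := leq_trans (nth_sorted_geq sla xy) (H x); lia.
by case: (ltngtP r r') => [rr|rr|-> //]; [case: (lt_false r r')|case: (lt_false r' r)].
Qed.

Lemma sum_col la m : head 0 la <= m -> sorted geq la -> \sum_(j < m) col_len la j = sumn la.
Proof.
move=> hm srt.
have : all (fun x => x <= m) la.
  by apply/(all_nthP 0) => i _; apply: leq_trans hm; rewrite -nth0 nth_sorted_geq.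
elim: la {hm srt} => [_|x la IHla /= /andP [xm /IHla <-]]; first by rewrite big1.
rewrite big_split /=; congr (_ + _).
rewrite -[RHS]muln1 -{2}[x]card_ord -sum_nat_const (big_ord_widen m (fun=> 1) xm).
by rewrite [RHS]big_mkcond; apply: eq_bigr => j _; case: (_ < _).
Qed.

Lemma head_size_sumn la : 0 \notin la -> head 0 la + size la <= (sumn la).+1.
Proof.
case: la => // x la; rewrite inE negb_or /= => /andP [_ /leq_size_sumn H].
by rewrite addnS ltnS leq_add2l.
Qed.

Lemma sum_lt_nth la j : \sum_(r < size la) (j < nth 0 la r) = col_len la j.
Proof.
elim: la => [|x la IHla]; first by rewrite big_ord0.
by rewrite big_ord_recl /= IHla.
Qed.

Section AlmostExtended.

Variables (n : nat) (la : seq nat).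
Hypotheses (la_part : is_part la) (la_small : sumn la < n).

Let la_sorted : sorted geq la. Proof. by case/andP: la_part. Qed.
Local Notation l0 := (nth 0 la 0).

(** The corner hook of a nonempty [la] is at most its size, hence less than n. This slack drives
    most of the arithmetic below. *)
Lemma small_hook : l0 + size la <= n.
Proof.
apply: leq_trans la_small; rewrite nth0; apply: head_size_sumn.
by case/andP: la_part.
Qed.

(* extend n la / g is a horizontal strip, in terms of row lengths. *)
Definition below_extend (g : seq nat) : Prop :=
  [/\ is_part g, forall r, nth 0 la r <= nth 0 g r,
      forall r, nth 0 g r.+1 <= nth 0 la r & nth 0 g 0 <= n + l0].

Lemma extend_below : below_extend (extend n la).
Proof.
case/andP: la_part => srt la0; split=> [|r|r|].
- rewrite /is_part /extend inE negb_or la0 andbT; apply/andP; split.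
    by case: (la) srt => //= x s ->; rewrite leq_addl.
  by have := la_small; lia.
- case: r => [|r] /=; first by rewrite nth0 leq_addl.
  exact: nth_sorted_geq.
- by [].
- by rewrite /= nth0.
Qed.

Section OneShape.

Variable g : seq nat.
Hypothesis g_below : below_extend g.

Let g_part : is_part g. Proof. by case: g_below. Qed.
Let g_sorted : sorted geq g. Proof. by case/andP: g_part. Qed.
Let ge_la r : nth 0 la r <= nth 0 g r. Proof. by case: g_below. Qed.
Let le_la r : nth 0 g r.+1 <= nth 0 la r. Proof. by case: g_below. Qed.
Local Notation g0 := (nth 0 g 0).

Lemma col_below j : col_len la j <= col_len g j <= (col_len la j).+1.
Proof.
apply/andP; split; rewrite leqNgt; apply/negP; rewrite lt_col // => H.
  by have := leq_trans H (ge_la _); rewrite -lt_col // ltnn.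
by have := leq_trans H (le_la _); rewrite -lt_col // ltnn.
Qed.

Lemma col_la_size j : col_len la j <= size la.
Proof. exact: count_size. Qed.

Lemma col_below_out j : l0 <= j < g0 -> col_len g j = 1.
Proof.
move=> /andP [lj jg]; apply: eq_col => // -[|r]; first by rewrite jg.
rewrite ltnS ltn0; apply/esym/negbTE; rewrite -leqNgt.
exact: leq_trans (le_la r) (leq_trans (nth_sorted_geq la_sorted (leq0n r)) lj).
Qed.

Lemma hook_bottom j : j < g0 -> hook g (0, j) + j.+1 = g0 + col_len g j.
Proof.
move=> jg; rewrite hookE //.
have : 0 < col_len g j by rewrite lt_col.
lia.
Qed.

(** Row r + 1 of [g] is at most row r of [la], and columns exceed those of [la] by at most one, so
    these hooks are bounded through the corner hook of [la]. *)
Lemma hook_upper r j : j < nth 0 g r.+1 -> hook g (r.+1, j) <= n.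
Proof.
move=> jg; rewrite hookE //.
have jla := leq_trans jg (le_la r).
have := jla; rewrite -lt_col // => rj.
have /andP [_ cg] := col_below j.
have := col_la_size j; have := small_hook.
have := nth_sorted_geq la_sorted (leq0n r); have := le_la r.
lia.
Qed.

(** Hooks above the bottom row are at most n, and so are those of bottom cells from column l0 on,
    where columns have height 1. The bottom cell of column j has the hook length g0 + col_len g j -
    j - 1. *)
Lemma core_below :
  is_core n g <-> forall j, j < l0 -> g0 + col_len g j <> n.+2 + j.
Proof.
rewrite /is_core g_part /=; split=> [/allP H j jl E|H].
  have jg : j < g0 by exact: leq_trans jl (ge_la 0).
  have /H : (0, j) \in cells g by rewrite mem_cells.
  have := hook_bottom jg; lia.
apply/allP => -[[|r] j]; rewrite mem_cells => jg; last first.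
  by rewrite neq_ltn ltnS hook_upper.
move=> /=; have := hook_bottom jg; case: (ltnP j l0) => jl; first by have := H j jl; lia.
rewrite col_below_out ?jl //; have [_ _ _ +] := g_below; lia.
Qed.

(** Counting by columns, only the bottom cell of a column j < l0 can have a hook longer than n; the
    columns from l0 on contribute one cell each. *)
Lemma deg_below :
  deg n g = \sum_(j < l0) (col_len g j - (n.+1 + j < g0 + col_len g j)) + (g0 - l0).
Proof.
rewrite /deg -sum1_count big_mkcond /cells big_allpairs_dep /=.
transitivity (\sum_(r < size g) \sum_(j < g0)
    ((j < nth 0 g r) && (hook g (nat_of_ord r, nat_of_ord j) < n.+1))).
  rewrite (_ : iota 0 (size g) = index_iota 0 (size g)); last by rewrite /index_iota subn0.
  rewrite big_mkord; apply: eq_bigr => r _.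
  rewrite (_ : iota 0 _ = index_iota 0 (nth 0 g r)); last by rewrite /index_iota subn0.
  rewrite big_mkord (big_ord_widen _ (fun j => if hook g (nat_of_ord r, j) < n.+1 then 1 else 0)
    (nth_sorted_geq g_sorted (leq0n r))).
  by rewrite big_mkcond; apply: eq_bigr => j _; do 2!case: (_ < _).
rewrite exchange_big /=.
have colE j : j < g0 -> \sum_(r < size g)
    ((j < nth 0 g r) && (hook g (nat_of_ord r, j) < n.+1)) =
    col_len g j - (n.+1 + j < g0 + col_len g j).
  move=> jx; move: (jx) (hook_bottom jx).
  case: g hook_upper => [|x s] //= hook_up.
  rewrite !big_ord_recl /= => {}jx hb; rewrite jx /=.
  have -> : \sum_(i < size s) ((j < nth 0 s i) && (hook (x :: s) (bump 0 i, j) < n.+1)) =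
            \sum_(i < size s) (j < nth 0 s i).
    apply: eq_bigr => i _; case: ltnP => //= ji; rewrite ltnS.
    by rewrite (hook_up i j).
  move: hb; rewrite /col_len /= jx -/(col_len s j) -sum_lt_nth.
  set X := \sum_(i < size s) _; set hk := hook _ _; lia.
under eq_bigr => j _ do rewrite colE //.
have l0g0 := ge_la 0.
rewrite -(big_mkord xpredT (fun j => col_len g j - (n.+1 + j < g0 + col_len g j))).
rewrite (@big_cat_nat _ _ _ l0) //= big_mkord; congr (_ + _).
rewrite big_nat (eq_bigr (fun=> 1)) => [|j jl]; last first.
  rewrite (col_below_out jl); have [_ _ _ +] := g_below; lia.
by rewrite -big_nat sum_nat_const_nat muln1.
Qed.

End OneShape.

End AlmostExtended.

Lemma sumn_nth (la : seq nat) m : size la <= m -> sumn la = \sum_(i < m) nth 0 la i.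
Proof.
elim: la m => [|x la IHla] m; first by rewrite big1 // => i _; rewrite nth_nil.
by case: m => // m lam; rewrite big_ord_recl /= (IHla m).
Qed.

Lemma add_one_box (la mu : seq nat) : (forall i, nth 0 la i <= nth 0 mu i) ->
  sumn mu = (sumn la).+1 -> exists r, forall i, nth 0 mu i = nth 0 la i + (i == r).
Proof.
move=> le_i; pose m := maxn (size la) (size mu).
rewrite (@sumn_nth la m) ?leq_maxl // (@sumn_nth mu m) ?leq_maxr // => sum_mu.
have : \sum_(i < m) (nth 0 mu i - nth 0 la i) = 1 by rewrite sumnB // sum_mu subSnn.
move/eqP/sum_nat_eq1 => [r [_ r1 r0]].
exists (nat_of_ord r) => i; case: (ltnP i m) => im; last first.
  rewrite !nth_default ?(leq_trans _ im) ?leq_maxl ?leq_maxr // gtn_eqF //.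
  exact: leq_trans (ltn_ord r) im.
have le_ii := le_i i; case: (eqVneq i r) => [->|ir].
  by rewrite -(subnK (le_i r)) r1 addnC.
have /eqP := r0 (Ordinal im) ir isT; rewrite subn_eq0 addn0 => le_ii'.
by apply/eqP; rewrite eqn_leq le_ii le_ii'.
Qed.

(** N steps of size at least one with a total of N or N + 1 leave room for at most one double step,
    and avoiding [w] forces it to jump over [w]. *)
Lemma gap_sequence (a : nat -> nat) (N w : nat) :
  (forall i, i < N -> a i < a i.+1) -> a 0 <= w ->
  a N = a 0 + N + (w <= a 0 + N) ->
  (forall i, i <= N -> a i <> w) ->
  forall i, i <= N -> a i = a 0 + i + (w <= a 0 + i).
Proof.
move=> a_incr w0 aN a_w.
have a_add i d : i + d <= N -> a i + d <= a (i + d).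
  elim: d => [|d IHd]; first by rewrite !addn0.
  rewrite !addnS => idN; apply: leq_trans (a_incr _ idN).
  by rewrite ltnS IHd // ltnW.
move=> i iN.
have h1 := a_add 0 i iN; have h2 := a_add i (N - i); rewrite subnKC // in h2.
have {}h2 := h2 (leqnn N); rewrite add0n in h1.
have h3 : a i <= a 0 + i + 1 by lia.
case: (ltnP (a i) (a 0 + i + 1)) => ai.
  have E : a i = a 0 + i by lia.
  case: (leqP w (a 0 + i)) => wi; last by rewrite E addn0.
  have iw : w - a 0 <= i by lia.
  (* Unit steps up to i would give the value [w] at the index w - a 0. *)
  have k1 := a_add 0 (w - a 0); have k2 := a_add (w - a 0) (i - (w - a 0)).
  rewrite subnKC // in k2; have := k1 (leq_trans iw iN); have := k2 iN.
  rewrite add0n => k3 k4; case: (a_w (w - a 0)); lia.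
have E : a i = a 0 + i + 1 by lia.
case: (leqP w (a 0 + i)) => wi; first by [].
have wN : w - a 0 - 1 <= N by lia.
have iw : i <= w - a 0 - 1 by lia.
(* If the double step came too early, the unit steps after it would reach [w] at the index w - a 0 -
   1. *)
have k1 := a_add i (w - a 0 - 1 - i); rewrite subnKC // in k1.
have k2 := a_add (w - a 0 - 1) (N - (w - a 0 - 1)); rewrite subnKC // in k2.
have k3 := k1 wN; have k4 := k2 (leqnn _); case: (a_w (w - a 0 - 1)) => //; lia.
Qed.

Lemma col_included g g' j : sorted geq g -> sorted geq g' -> included g g' ->
  col_len g j <= col_len g' j.
Proof.
move=> srt srt' /includedP H; rewrite leqNgt; apply/negP; rewrite lt_col // => jg.
by have := leq_trans jg (H _); rewrite -lt_col // ltnn.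
Qed.

Lemma component_sub (S R : seq (nat * nat)) :
  R \in components S -> uniq R /\ {subset R <= S}.
Proof.
move=> /mapP [x _ ->]; split.
  by rewrite map_inj_uniq ?enum_uniq //; exact: val_inj.
by move=> y /mapP [z _ ->]; exact: valP.
Qed.

Lemma component_pair (S : seq (nat * nat)) (x y : nat * nat) :
  S =i [:: x; y] -> x != y -> adjacent x y ->
  exists2 R, R \in components S & perm_eq R [:: x; y].
Proof.
move=> SE xy adj.
have xS : x \in S by rewrite SE inE eqxx.
have yS : y \in S by rewrite SE !inE eqxx orbT.
pose e := fun a b : seq_sub S => adjacent (val a) (val b).
pose X := SeqSub xS; pose Y := SeqSub yS.
exists [seq val z | z in connect e X].
  by apply/mapP; exists X; rewrite ?mem_enum.
apply: uniq_perm; first by rewrite map_inj_uniq ?enum_uniq //; exact: val_inj.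
  by rewrite /= inE xy.
move=> z; apply/mapP/idP => [[u _ ->]|]; first by rewrite -SE; exact: valP.
rewrite !inE => /orP [/eqP ->|/eqP ->]; [exists X|exists Y] => //; rewrite mem_enum.
  exact: connect0.
exact: connect1.
Qed.

Section AddBox.

Variables (la nu : seq nat) (r : nat).
Hypotheses (la_part : is_part la) (nu_part : is_part nu).
Hypothesis nu_box : forall i, nth 0 nu i = nth 0 la i + (i == r).
Let la_sorted : sorted geq la. Proof. by case/andP: la_part. Qed.
Local Notation lr := (nth 0 la r).

Lemma box_addable : 0 < r -> lr < nth 0 la r.-1.
Proof.
move=> r0; have /andP [nu_srt _] := nu_part.
have := nth_sorted_geq nu_srt (leq_pred r); rewrite !nu_box eqxx addn1.
by rewrite ltn_eqF ?addn0 // prednK.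
Qed.

Lemma box_row_bound : r <= size la.
Proof.
case: (posnP r) => [-> //|r0]; have := box_addable r0.
case: (ltnP r.-1 (size la)) => [|lar]; first by rewrite prednK.
by rewrite [nth 0 la r.-1]nth_default.
Qed.

Lemma col_la_box : col_len la lr = r.
Proof.
apply: eq_col => // i; case: (ltnP i r) => ir.
  apply/esym; apply: leq_trans (box_addable (leq_ltn_trans (leq0n _) ir)) _.
  by apply: nth_sorted_geq => //; lia.
by apply/esym/negbTE; rewrite -leqNgt nth_sorted_geq.
Qed.

Lemma col_nu_box j : col_len nu j = col_len la j + (j == lr).
Proof.
have /andP [nu_srt _] := nu_part.
apply: eq_col => // i; rewrite nu_box; case: (eqVneq j lr) => [->|jr].
  rewrite addn1 ltnS col_la_box; case: (ltngtP i r) => [ir|ir|->]; last by rewrite addn1 ltnSn.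
    rewrite addn0; apply/esym; rewrite -lt_col ?col_la_box //.
  by rewrite addn0 -lt_col // col_la_box ltnNge (ltnW ir).
rewrite addn0 lt_col //; case: (eqVneq i r) => [->|]; last by rewrite addn0.
by rewrite addn1 ltnS [RHS]leq_eqVlt (negPf jr).
Qed.

End AddBox.

Section StripChain.

Variables (n : nat) (la nu : seq nat) (c : seq (seq nat)).
Hypotheses (la_part : is_part la) (la_small : sumn la < n).
Hypothesis chain : strip_chain n 1 la nu c.

Let la_sorted : sorted geq la. Proof. by case/andP: la_part. Qed.
Local Notation l0 := (nth 0 la 0).
Local Notation st i := (nth [::] (nu :: c) i).
Local Notation len i := (nth 0 (st i) 0).

Lemma chain_size : size c = n.-1.
Proof. by case/and3P: chain => _ _ /and5P [_ _ _ _ /eqP ->]; rewrite subn1. Qed.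

Lemma chain_last : st n.-1 = extend n la.
Proof.
case/and3P: chain => _ _ /and5P [_ _ _ /eqP <- _].
by rewrite -chain_size -[size c]/(size (nu :: c)).-1 nth_last.
Qed.

Lemma chain_step i : i < n.-1 -> strip_step n (st i) (st i.+1).
Proof.
rewrite -chain_size => ic; case/and3P: chain => _ _ /and5P [_ _ /(pathP [::]) H _ _].
exact: H.
Qed.

Lemma chain_core i : i <= n.-1 -> is_core n (st i).
Proof.
case: i => [_|i /chain_step]; first by case/and3P: chain => _ _ /and5P [].
by case/andP => /and4P [].
Qed.

Lemma chain_included i j : i <= j <= n.-1 -> included (st i) (st j).
Proof.
case/andP => /subnK <-; elim: (j - i) => [_|d IHd]; first exact/includedP.
rewrite addSn => dn; apply: included_trans (IHd (ltnW dn)) _.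
by case/andP: (chain_step dn) => /and4P [].
Qed.

Lemma chain_deg i : i < n.-1 -> deg n (st i.+1) = (deg n (st i)).+1.
Proof. by case/chain_step/andP => /and4P [_ _ _ /eqP]. Qed.

Lemma chain_len i : i < n.-1 -> len i < len i.+1.
Proof.
move=> /chain_step /andP [_]; rewrite mem_skew_cells -nth0 => /andP [].
lia.
Qed.

Lemma chain_below i : i <= n.-1 -> below_extend n la (st i).
Proof.
move=> i_n; have [_ _ below_e len_e] := extend_below la_part la_small.
have /andP [i_part _] := chain_core i_n.
have /includedP i_e : included (st i) (extend n la).
  by rewrite -chain_last chain_included // i_n leqnn.
have /includedP nu_i : included nu (st i) by apply: (@chain_included 0).
have [nu_srt ext_srt] : sorted geq nu /\ sorted geq (extend n la).
  have /andP [/andP [-> _] _] := chain_core (leq0n _).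
  by have [/andP [-> _] _ _ _] := extend_below la_part la_small.
case/and3P: chain => _ _ /and5P [_ + _ _ _].
move/(horizontal_stripP ext_srt nu_srt) => [_ H].
split=> [//|r|r|].
- exact: leq_trans (H r) (nu_i r).
- exact: leq_trans (i_e _) (below_e r).
- exact: leq_trans (i_e 0) len_e.
Qed.

(** Each column j < l0 gains a cell from the new row, but its bottom cell now has a hook longer than
    n, so it still counts col_len la j; the n columns beyond add n. *)
Lemma deg_extend : deg n (extend n la) = sumn la + n.
Proof.
have ext := extend_below la_part la_small.
have e0 : nth 0 (extend n la) 0 = n + l0 by rewrite /= nth0.
rewrite (deg_below la_part la_small ext) e0 addnK; congr (_ + _).
rewrite -(sum_col (leqnn _) la_sorted) -nth0; apply: eq_bigr => j _.
have jl := ltn_ord j.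
have -> : col_len (extend n la) j = (col_len la j).+1.
  by rewrite /col_len /= -nth0 ltn_addl.
by rewrite (_ : _ < _ = true) ?subn1 //; lia.
Qed.

Lemma chain_deg0 : deg n nu = (sumn la).+1.
Proof.
have H i : i <= n.-1 -> deg n (st i) = deg n nu + i.
  elim: i => [|i IHi] i_n; first by rewrite addn0.
  by rewrite chain_deg // IHi ?addnS // ltnW.
have := H _ (leqnn _); rewrite chain_last deg_extend; have := la_small; lia.
Qed.

Lemma chain_len_add i d : i + d <= n.-1 -> len i + d <= len (i + d).
Proof.
elim: d => [|d IHd]; first by rewrite !addn0.
rewrite !addnS => idN; apply: leq_trans (chain_len idN).
by rewrite ltnS IHd // ltnW.
Qed.

(** Each of the n - 1 steps lengthens the bottom row, whose final length is n + l0. *)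
Lemma chain_len0 : l0 <= nth 0 nu 0 <= l0.+1.
Proof.
have [_ /(_ 0) -> _ _] := chain_below (leq0n _).
have := @chain_len_add 0 n.-1 (leqnn _); rewrite add0n chain_last.
rewrite [nth 0 (extend _ _) 0]/= -nth0 [st 0]/=; have := la_small; lia.
Qed.

(** The bottom row of [nu] is so short that no hook exceeds n. Hence its degree, one more than the
    size of [la], is its size. *)
Lemma chain_box : exists r, forall i, nth 0 nu i = nth 0 la i + (i == r).
Proof.
have nu_below : below_extend n la nu := chain_below (leq0n _).
have [nu_part ge_la _ _] := nu_below.
apply: add_one_box => //.
rewrite -chain_deg0 (deg_below la_part la_small nu_below) /=.
have nu_core := (core_below la_part la_small nu_below).1 (chain_core (leq0n _) : is_core n nu).
have /andP [nu_srt _] := nu_part.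
rewrite -(sum_col (leqnn _) nu_srt) -nth0 -(big_mkord xpredT (col_len nu)).
rewrite (@big_cat_nat _ _ _ l0) ?ge_la //= big_mkord; congr (_ + _).
  apply: eq_bigr => j _; have := nu_core j (ltn_ord j).
  have /andP [_ cj] := col_below la_part nu_below j.
  have := col_la_size la j; have := small_hook la_part la_small.
  have /andP [_ n0] := chain_len0.
  move=> h1 h2 h3; rewrite (_ : _ < _ = false) ?subn0 //=; apply/negP; move: h3; lia.
rewrite big_nat (eq_bigr (fun=> 1)) => [|j jl]; last exact: (col_below_out la_part nu_below).
by rewrite -big_nat sum_nat_const_nat muln1.
Qed.

Variable r : nat.
Hypothesis nu_box : forall i, nth 0 nu i = nth 0 la i + (i == r).
Local Notation lr := (nth 0 la r).
(* At this length of the bottom row, the new box on top of column lr would give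
   the bottom cell of that column the hook length n + 1. *)
Local Notation skip := (n.+1 + lr - r).

Let nu_part : is_part nu. Proof. by have [] := chain_below (leq0n _). Qed.
Let box_addable := box_addable nu_part nu_box.
Let box_row_bound := box_row_bound nu_part nu_box.
Let col_la_box := col_la_box la_part nu_part nu_box.
Let col_nu_box := col_nu_box la_part nu_part nu_box.

Lemma chain_len_start : len 0 = l0 + (0 == r).
Proof. exact: nu_box. Qed.

(** For 0 < r the core condition in column [lr] forbids the length [skip], and the final length n +
    l0 leaves room for exactly one gap. For r = 0, [skip] is n + 1 + l0, beyond every length, and
    there is no gap. *)
Lemma chain_lenE i : i <= n.-1 -> len i = len 0 + i + (skip <= len 0 + i).
Proof.
have := small_hook la_part la_small; have := box_row_bound; move=> rs sh.
have lastE : len n.-1 = n + l0 by rewrite chain_last /= nth0.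
apply: (gap_sequence (a := fun i => len i)) => [j /chain_len //||| j jn].
- rewrite chain_len_start; case: (posnP r) => [->|r0]; first by rewrite eqxx; lia.
  by rewrite [0 == r]ltn_eqF //; lia.
- rewrite lastE chain_len_start; case: (posnP r) => [->|r0]; first by rewrite eqxx; lia.
  have := box_addable r0; have := nth_sorted_geq la_sorted (leq0n r.-1).
  by rewrite [0 == r]ltn_eqF //; lia.
case: (posnP r) => [r00|r0].
  have := @chain_len_add j (n.-1 - j); rewrite subnKC // lastE => /(_ (leqnn _)).
  by rewrite r00; lia.
have lr0 : lr < l0 := leq_trans (box_addable r0) (nth_sorted_geq la_sorted (leq0n _)).
have j_below := chain_below jn.
have := (core_below la_part la_small j_below).1 (chain_core jn) lr lr0.
have /andP [_] := col_below la_part j_below lr.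
have : r < col_len (st j) lr.
  have [/andP [st_srt _] _ _ _] := j_below; rewrite lt_col //.
  have /includedP /(_ r) := @chain_included 0 j jn; rewrite /= nu_box eqxx; lia.
rewrite col_la_box; lia.
Qed.

(** This supplies the stages at which the core condition is tested in [chain_col]. *)
Lemma chain_visits v : len 0 <= v <= n + l0 -> v <> skip ->
  exists2 i, i <= n.-1 & len i = v.
Proof.
have := small_hook la_part la_small; have := box_row_bound => rs sh /andP [v0 vn] vs.
pose i := v - len 0 - (skip < v).
have [[r0 l0E]|[r0 lr0 l0E]] : (r = 0 /\ len 0 = l0.+1) \/ [/\ 0 < r, lr < l0 & len 0 = l0].
- rewrite chain_len_start; case: (posnP r) => r0; [left|right]; first by rewrite r0 addn1.
  rewrite ltn_eqF ?addn0 //; split=> //.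
  exact: leq_trans (box_addable r0) (nth_sorted_geq la_sorted (leq0n _)).
- have i_n : i <= n.-1 by rewrite /i r0; rewrite l0E in v0 *; lia.
  by exists i => //; rewrite chain_lenE // /i; lia.
have i_n : i <= n.-1 by rewrite /i; rewrite l0E in v0 *; lia.
by exists i => //; rewrite chain_lenE // /i; lia.
Qed.

Lemma chain_len_le i j : i <= n.-1 -> j <= n.-1 -> len i <= len j -> i <= j.
Proof.
move=> i_n j_n; case: (leqP i j) => // ji.
have := @chain_len_add j (i - j); rewrite subnKC ?(ltnW ji) // => /(_ i_n); lia.
Qed.

Lemma chain_col_leq i j k : i <= k <= n.-1 -> col_len (st i) j <= col_len (st k) j.
Proof.
move=> /andP [ik k_n]; apply: col_included; last by rewrite chain_included ?ik.
  by have [/andP [? _] _ _ _] := chain_below (leq_trans ik k_n).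
by have [/andP [? _] _ _ _] := chain_below k_n.
Qed.

(* Column j < l0 gets its top cell when the bottom row reaches the length
   n + 2 + j - la'_j, since otherwise some cell of the bottom row would have
   hook length n + 1. *)
Lemma chain_col i j : i <= n.-1 -> j < l0 ->
  col_len (st i) j = col_len la j + ((j == lr) || (n.+2 + j <= len i + col_len la j)).
Proof.
have := small_hook la_part la_small; have := box_row_bound => rs sh i_n jl.
have core k : k <= n.-1 -> len k + col_len (st k) j <> n.+2 + j.
  by move=> k_n; apply: (core_below la_part la_small (chain_below k_n)).1 => //; apply: chain_core.
have bounds k : k <= n.-1 -> col_len la j <= col_len (st k) j <= (col_len la j).+1.
  by move=> k_n; apply: (col_below la_part (chain_below k_n)).
have hi := bounds i i_n.
case: (eqVneq j lr) => [jr|jr] /=.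
  have := @chain_col_leq 0 j i i_n; rewrite [st 0]/= col_nu_box jr eqxx -jr; lia.
have cs := col_la_size la j; have l0E := chain_len_start.
have c0 : 0 < col_len la j by rewrite lt_col.
have len_i : len 0 <= len i <= n + l0.
  have [_ _ _ ->] := chain_below i_n; rewrite andbT.
  by have := @chain_len_add 0 i; rewrite add0n => /(_ i_n); lia.
(* Neither critical length of column j, n + 2 + j - col_len la j or the one before it, is the
   skipped length, so the chain can visit both. *)
have skip_col : (r = 0 /\ n.+2 + j < skip + col_len la j) \/
    (0 < r /\ (n.+2 + j < skip + col_len la j \/ skip + col_len la j < n.+1 + j)).
  case: (posnP r) => [r0|r0]; first by left; split=> //; rewrite r0; lia.
  right; split=> //; case: (ltngtP j lr) => [jlr|jlr|/eqP]; last by rewrite (negPf jr).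
    by left; have := jlr; rewrite -lt_col //; lia.
  by right; have := col_anti la (ltnW jlr); rewrite col_la_box; lia.
(* At the stage k of critical length the column cannot keep its old height, which would give a hook
   n + 1; it has grown by then, and stays so. *)
case: (leqP (n.+2 + j) (len i + col_len la j)) => [m_le|lt_m].
  have [||k k_n kE] := @chain_visits (n.+2 + j - col_len la j); [lia|lia|].
  have ki : k <= i by apply: chain_len_le => //; lia.
  have := core k k_n; have := bounds k k_n; have := @chain_col_leq k j i.
  by rewrite ki i_n => /(_ isT); lia.
apply/eqP; rewrite addn0 eqn_leq; case/andP: (hi) => -> _; rewrite andbT leqNgt.
apply/negP => top_i; have core_i := core i i_n.
(* A top cell present too early would still be there one unit before the critical length, and give a
   hook n + 1. *)
have [||k k_n kE] := @chain_visits (n.+1 + j - col_len la j); [lia|lia|].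
have ki : i <= k by apply: chain_len_le => //; lia.
have := core k k_n; have := bounds k k_n; have := @chain_col_leq i j k.
by rewrite ki k_n => /(_ isT); lia.
Qed.

Lemma chain_skew_cells i k j : i < n.-1 ->
  (k, j) \in skew_cells (st i.+1) (st i) ->
  (k = 0 /\ len i <= j < len i.+1) \/
  [/\ k = col_len la j, 0 < k, j != lr &
      len i + col_len la j < n.+2 + j <= len i.+1 + col_len la j].
Proof.
move=> i_n; rewrite mem_skew_cells => /andP [jge jlt].
case: k jge jlt => [|k] jge jlt; [by left; rewrite jge|right].
have [/andP [srt _] _ _ _] := chain_below (ltnW i_n).
have [/andP [srt' _] _ /(_ k) le_k _] := chain_below i_n.
have jl : j < l0.
  exact: leq_trans (leq_trans jlt le_k) (nth_sorted_geq la_sorted (leq0n k)).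
have := chain_col (ltnW i_n) jl; have := chain_col i_n jl.
move: jge jlt; rewrite leqNgt -!lt_col //.
case: (j == lr) => /=; first by lia.
by case: leqP; case: leqP; split=> //; lia.
Qed.

(* Every step adds one cell to the bottom row and at most one other cell, except
   that the step over the skipped length adds only a domino to the bottom row. *)
Lemma chain_row_cells i k j j' : i < n.-1 ->
  (k, j) \in skew_cells (st i.+1) (st i) -> (k, j') \in skew_cells (st i.+1) (st i) ->
  j < j' -> [/\ 0 < r, k = 0, j.+1 = skip & j' = skip].
Proof.
move=> i_n kj kj' jj'.
have := small_hook la_part la_small; have := box_row_bound => rs sh.
have E := chain_lenE (ltnW i_n); have E' := chain_lenE i_n.
have l0E := chain_len_start.
have [_ _ _ len_le] := chain_below i_n.
have cs := col_la_size la.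
have r_cases : (r = 0 /\ len 0 = l0.+1) \/ (0 < r /\ len 0 = l0).
  by rewrite l0E; case: (posnP r) => r0; [left; rewrite r0 addn1|right; rewrite ltn_eqF ?addn0].
have [[k0 h]|[kE k0 jr h]] := chain_skew_cells i_n kj;
  have [[k0' h']|[kE' k0' jr' h']] := chain_skew_cells i_n kj'; try lia.
  have r0 : 0 < r by case: r_cases => [[r0 l0E']|[]//]; rewrite r0 in E E' *; lia.
  by split=> //; lia.
have r0 : 0 < r by case: r_cases => [[r0 l0E']|[]//]; rewrite r0 in E E' *; lia.
case: (ltngtP j' lr) => [jlr|jlr|/eqP]; last by rewrite (negPf jr').
  by have := jlr; rewrite -lt_col //; lia.
by have := col_anti la (ltnW jlr); rewrite col_la_box; lia.
Qed.

Lemma chain_domino i k R : i < n.-1 ->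
  R \in components (skew_cells (st i.+1) (st i)) ->
  size R = 2 -> all (fun x => x.1 == k) R ->
  [/\ 0 < r, k = 0 & head_col R = skip].
Proof.
move=> i_n /component_sub [uR sub]; case: R uR sub => [|[k1 j1] [|[k2 j2] [|]]] //=.
rewrite andbT inE => uR sub _ /and3P [/eqP k1k /eqP k2k _]; subst k1 k2.
have j12 : j1 != j2 by apply: contra uR => /eqP ->.
have kj1 := sub (k, j1) (mem_head _ _).
have kj2 : (k, j2) \in skew_cells (st i.+1) (st i) by apply: sub; rewrite !inE eqxx orbT.
rewrite /head_col !big_cons big_nil /= maxn0.
case: (ltngtP j1 j2) j12 => // [lt12|lt21] _.
  by have [r0 -> e1 e2] := chain_row_cells i_n kj1 kj2 lt12; split=> //; lia.
by have [r0 -> e1 e2] := chain_row_cells i_n kj2 kj1 lt21; split=> //; lia.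
Qed.

Lemma chain_domino_exists : 0 < r -> exists2 i, i < n.-1 & exists2 R,
  R \in components (skew_cells (st i.+1) (st i)) &
  (size R == 2) && all (fun x => x.1 == 0) R.
Proof.
move=> r0; have := small_hook la_part la_small; have := box_row_bound => rs sh.
have l0E : len 0 = l0 by rewrite chain_len_start ltn_eqF ?addn0.
have lr0 : lr < l0 := leq_trans (box_addable r0) (nth_sorted_geq la_sorted (leq0n _)).
(* The stage with bottom row of length [skip - 1]; the next one has length [skip + 1]. *)
pose i := skip - 1 - l0; have i_n : i < n.-1 by rewrite /i; lia.
have E : len i = skip - 1 by rewrite chain_lenE ?(ltnW i_n) // l0E /i; lia.
have E' : len i.+1 = skip + 1 by rewrite chain_lenE // l0E /i; lia.
have [|||R RC pR] := @component_pair (skew_cells (st i.+1) (st i)) (0, skip - 1) (0, skip).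
- move=> [k j]; rewrite !inE !xpair_eqE; apply/idP/idP => [kj|].
    have [[-> h]|[kE k0 jr h]] := chain_skew_cells i_n kj; first by rewrite E E' in h; lia.
    (* No column gets its top cell in this step: left of [lr] the critical length exceeds
       [skip + 1], and right of [lr] it is already passed. *)
    rewrite E E' in h; case: (ltngtP j lr) => [jlr|jlr|/eqP]; last by rewrite (negPf jr).
      by have := jlr; rewrite -lt_col //; lia.
    by have := col_anti la (ltnW jlr); rewrite col_la_box; lia.
  by rewrite -andb_orr => /andP [/eqP -> kj]; rewrite mem_skew_cells E E'; lia.
- by rewrite xpair_eqE /=; lia.
- by rewrite /adjacent /=; apply/orP; left; lia.
exists i => //; exists R => //.
by rewrite (perm_size pR) (perm_all _ pR).
Qed.

End StripChain.

Lemma small_core n g : is_part g -> sumn g <= n -> is_core n g.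
Proof.
move=> g_part gn; have /andP [srt g0] := g_part.
have hook_le (k j : nat) : j < nth 0 g k -> hook g (k, j) <= n.
  move=> jg; rewrite hookE //; have := head_size_sumn g0; rewrite -nth0.
  have := nth_sorted_geq srt (leq0n k); have := jg; rewrite -lt_col //.
  have : col_len g j <= size g := count_size _ _.
  move: jg gn; move: (nth 0 g k) (nth 0 g 0) (col_len g j) => a b d.
  move: (sumn g) (size g) => ss sz; lia.
rewrite /is_core g_part; apply/allP => -[k j]; rewrite mem_cells => /hook_le.
by rewrite neq_ltn ltnS => ->.
Qed.

(** * Construction of the strip chain *)

Section ChainExists.

Variables (n : nat) (la nu : seq nat) (r : nat).
Hypotheses (la_part : is_part la) (la_small : sumn la < n) (nu_part : is_part nu).
Hypothesis nu_box : forall i, nth 0 nu i = nth 0 la i + (i == r).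

Let la_sorted : sorted geq la. Proof. by case/andP: la_part. Qed.
Let nu_sorted : sorted geq nu. Proof. by case/andP: nu_part. Qed.
Let rs := box_row_bound nu_part nu_box.
Let sh := small_hook la_part la_small.
Local Notation l0 := (nth 0 la 0).
Local Notation lr := (nth 0 la r).
Local Notation nu0 := (nth 0 nu 0).
Local Notation skip := (n.+1 + lr - r).

Let box_cases : (r = 0 /\ nu0 = l0.+1) \/ [/\ 0 < r, lr < l0 & nu0 = l0].
Proof.
rewrite nu_box; case: (posnP r) => r0; [left|right]; first by rewrite r0 addn1.
rewrite ltn_eqF ?addn0 //; split=> //.
by apply: leq_trans (box_addable nu_part nu_box r0) (nth_sorted_geq la_sorted (leq0n _)).
Qed.

(** The row form of [chain_col] at bottom length [a]: a column j of height k in [la] has its top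
    cell in row k once n + 2 + j <= a + k, that is, j < a + k - (n + 1). The minimum with row k - 1
    of [la] keeps the strip horizontal. *)
Definition state_row (a k : nat) : nat :=
  if k == 0 then a
  else minn (nth 0 la k.-1) (maxn (nth 0 nu k) (a + k - n.+1)).

Definition state (a : nat) : seq nat :=
  [seq q <- mkseq (state_row a) (size la).+1 | 0 < q].

Lemma state_row_anti a k : l0 <= a -> state_row a k.+1 <= state_row a k.
Proof.
rewrite /state_row /=; case: k => [|k] la0 /=; first by rewrite (leq_trans (geq_minl _ _)).
rewrite (leq_trans (geq_minl _ _)) // leq_min (nth_sorted_geq la_sorted (leqnSn k)) /=.
by rewrite leq_max nu_box leq_addr.
Qed.

Lemma state_part a : l0 <= a -> is_part (state a).
Proof.
move=> la0; apply: is_part_filter; apply/(sortedP 0) => k.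
rewrite size_mkseq => kn; rewrite !nth_mkseq //; last exact: ltnW.
exact: state_row_anti.
Qed.

Lemma nth_state a k : l0 <= a -> nth 0 (state a) k = state_row a k.
Proof.
move=> la0; rewrite nth_pos_filter; last first.
  apply/(sortedP 0) => i; rewrite size_mkseq => i_n; rewrite !nth_mkseq //; last exact: ltnW.
  exact: state_row_anti.
case: (ltnP k (size la).+1) => kn; first by rewrite nth_mkseq.
rewrite nth_default ?size_mkseq // /state_row.
by case: k kn => // k kn; rewrite /= [nth 0 la k]nth_default // min0n.
Qed.

Lemma state_below a : nu0 <= a -> a <= n + l0 -> below_extend n la (state a).
Proof.
move=> nu0a an; have la0 : l0 <= a by rewrite (leq_trans _ nu0a) // nu_box leq_addr.
split=> [|k|k|]; rewrite ?nth_state //; first exact: state_part.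
  rewrite /state_row; case: k => [|k] //=.
  by rewrite leq_min (nth_sorted_geq la_sorted (leqnSn k)) leq_max nu_box leq_addr.
by rewrite /state_row /= geq_minl.
Qed.

Lemma col_state a j : nu0 <= a -> j < l0 ->
  col_len (state a) j = col_len la j + ((j == lr) || (n.+2 + j <= a + col_len la j)).
Proof.
move=> nu0a jl; have la0 : l0 <= a by rewrite (leq_trans _ nu0a) // nu_box leq_addr.
have c0 : 0 < col_len la j by rewrite lt_col.
have /andP [st_srt _] := state_part la0.
have box_col := col_la_box la_part nu_part nu_box.
apply: eq_col => // -[|k]; rewrite nth_state // /state_row /=; first by lia.
rewrite leq_min leq_max -[in j < nth 0 nu _]lt_col // (col_nu_box la_part nu_part nu_box).
rewrite -[in j < nth 0 la _]lt_col //.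
case: (eqVneq j lr) => [->|jr] /=; first by rewrite box_col; lia.
lia.
Qed.

Lemma state_core a : nu0 <= a -> a <= n + l0 -> a <> skip -> is_core n (state a).
Proof.
move=> nu0a an askip.
have la0 : l0 <= a by rewrite (leq_trans _ nu0a) // nu_box leq_addr.
apply/(core_below la_part la_small (state_below nu0a an)) => j jl.
rewrite nth_state // col_state // /state_row /=.
have box_col := col_la_box la_part nu_part nu_box.
by case: (eqVneq j lr) => [->|jr] /=; rewrite ?box_col; lia.
Qed.

(** In a column other than [lr], the top cell appears just when the bottom hook exceeds n, so the
    count does not change. The new box in column [lr] counts until [skip] is passed; its loss there
    makes the step by two raise the degree by one only. *)
Lemma state_deg a : nu0 <= a -> a <= n + l0 -> a <> skip ->
  deg n (state a) = sumn la + ((lr < l0) && (a < skip)) + (a - l0).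
Proof.
move=> nu0a an askip.
have la0 : l0 <= a by rewrite (leq_trans _ nu0a) // nu_box leq_addr.
rewrite (deg_below la_part la_small (state_below nu0a an)) nth_state // -[state_row a 0]/a.
congr (_ + _); rewrite -(sum_col (leqnn _) la_sorted) -nth0.
have box_col := col_la_box la_part nu_part nu_box.
transitivity (\sum_(j < l0)
    (col_len la j + (if j == lr :> nat then nat_of_bool (a < skip) else 0))).
  apply: eq_bigr => j _; rewrite col_state //.
  have := rs; have := sh; case: (eqVneq (nat_of_ord j) lr) => [->|jr] /=.
    by rewrite box_col; lia.
  by lia.
rewrite big_split /=; congr (_ + _); rewrite -big_mkcond /=.
case: (ltnP lr l0) => lrl0 /=; first by rewrite (big_pred1 (Ordinal lrl0)).
by rewrite big1 // => j /eqP jr; have := ltn_ord j; rewrite jr ltnNge lrl0.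
Qed.

(** The lengths that [chain_lenE] forces on any chain. *)
Definition state_len (i : nat) : nat := nu0 + i + (skip <= nu0 + i).

Lemma state_lenP i : i <= n.-1 ->
  [/\ nu0 <= state_len i, state_len i <= n + l0 & state_len i <> skip].
Proof.
move=> i_n; rewrite /state_len.
by case: box_cases => [[r0 l0E]|[r0 lr0 l0E]]; rewrite l0E ?r0; split; lia.
Qed.

Lemma state_start : state (state_len 0) = nu.
Proof.
have [nu_le _ _] := state_lenP (leq0n _).
have la0 : l0 <= state_len 0 by rewrite (leq_trans _ nu_le) // nu_box leq_addr.
have len0 : state_len 0 = nu0.
  by rewrite /state_len; case: box_cases => [[r0 l0E]|[r0 lr0 l0E]]; rewrite l0E ?r0; lia.
apply: eq_part => // [|k]; first exact: state_part.
rewrite nth_state // len0 /state_row; case: k => [|k] //=.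
have nu_k : nth 0 nu k.+1 <= nth 0 la k.
  rewrite nu_box; case: (eqVneq k.+1 r) => [kr|_].
    by have := box_addable nu_part nu_box; rewrite -kr /= addn1; apply.
  by rewrite addn0 nth_sorted_geq.
case: (ltnP k (size la)) => ks; last by move: nu_k; rewrite [nth 0 la k]nth_default //; lia.
have -> : nu0 + k.+1 - n.+1 = 0 by case: box_cases => [[r0 l0E]|[r0 lr0 l0E]]; rewrite l0E; lia.
by rewrite maxn0; apply/minn_idPr.
Qed.

Lemma state_end : state (state_len n.-1) = extend n la.
Proof.
have [nu_le _ _] := state_lenP (leqnn _).
have la0 : l0 <= state_len n.-1 by rewrite (leq_trans _ nu_le) // nu_box leq_addr.
have lenn : state_len n.-1 = n + l0.
  by rewrite /state_len; case: box_cases => [[r0 l0E]|[r0 lr0 l0E]]; rewrite l0E ?r0; lia.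
apply: eq_part => [||k]; first exact: state_part.
  by have [] := extend_below la_part la_small.
rewrite nth_state // lenn /state_row; case: k => [|k] /=; first by rewrite nth0.
apply/minn_idPl; rewrite leq_max.
by have := nth_sorted_geq la_sorted (leq0n k); lia.
Qed.

Lemma strip_chain_exists : exists c, strip_chain n 1 la nu c.
Proof.
have n0 : 0 < n by apply: leq_ltn_trans la_small.
pose c := [seq state (state_len i) | i <- iota 1 n.-1].
have cE i : i <= n.-1 -> nth [::] (nu :: c) i = state (state_len i).
  case: i => [|i] i_n /=; first by rewrite state_start.
  by rewrite (nth_map 0) ?size_iota // nth_iota.
have sum_nu : sumn nu = (sumn la).+1.
  pose m := (size la + size nu + r).+1.
  rewrite (@sumn_nth la m) ?(@sumn_nth nu m) /m; try lia.
  under eq_bigr => i _ do rewrite nu_box.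
  have rm : r < m by rewrite /m ltnS leq_addl.
  rewrite big_split /= -[RHS]addn1; congr (_ + _).
  rewrite (bigD1 (Ordinal rm)) //= eqxx big1 // => i.
  by rewrite -val_eqE => /negPf /= ->.
have [nu_below0 nu_below1 _] := state_lenP (leq0n n.-1).
exists c; rewrite /strip_chain; apply/and3P; split=> //.
  by apply: small_core => //; apply: ltnW.
apply/and5P; split.
- by apply: small_core => //; rewrite sum_nu.
- apply/horizontal_stripP => //.
    by have [/andP [] ] := extend_below la_part la_small.
  have [_ h1 h2 h3] := state_below nu_below0 nu_below1.
  rewrite state_start in h1 h2 h3; split=> [[|k]|k] /=; [by rewrite -nth0|exact: h2|exact: h1].
- apply/(pathP [::]) => i; rewrite size_map size_iota => i_n.
  rewrite cE ?(ltnW i_n) // -[nth _ c i]/(nth [::] (nu :: c) i.+1) cE //.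
  have [h1 h2 h3] := state_lenP (ltnW i_n); have [h1' h2' h3'] := state_lenP i_n.
  have nu_l0 : l0 <= nu0 by rewrite nu_box leq_addr.
  have lt_len : state_len i < state_len i.+1 by rewrite /state_len; lia.
  rewrite /strip_step /strong_cover !state_core //= mem_skew_cells -!nth0.
  rewrite !nth_state ?(leq_trans nu_l0) // !state_deg //=.
  apply/andP; split; [apply/andP; split|].
  + apply/includedP => k; rewrite !nth_state ?(leq_trans nu_l0) // /state_row.
    case: k => [|k] /=; first exact: ltnW.
    by rewrite leq_min geq_minl; apply: leq_trans (geq_minr _ _) _; lia.
  + move: h3 h3'; rewrite /state_len.
    by case: box_cases => [[r0 l0E]|[r0 lr0 l0E]]; rewrite l0E ?r0; lia.
  + by rewrite /state_row /=; lia.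
- rewrite (last_nth [::]) size_map size_iota cE // state_end //.
- by rewrite size_map size_iota subn1.
Qed.

End ChainExists.

(** * Affine Bruhat counter-tableaux as words *)

(** The prefix of length x of [u] codes lambda^(x). Null parts are kept, so that both sides have
    exactly x entries. *)
Definition array_word (n : nat) (A : seq (seq nat)) (u : seq nat) : Prop :=
  [/\ yam u, size u = n & forall x, x <= n -> raw_shape A x = mkseq (mult (take x u)) x].

Lemma abc_shape_word n A u x : array_word n A u -> x <= n ->
  abc_shape A x = word_shape (take x u).
Proof.
by move=> [_ un rawE] xn; rewrite /abc_shape rawE // /word_shape size_takel // un.
Qed.

Lemma mult_rcons u r i : mult (rcons u r) i = mult u i + (i == r).
Proof. by rewrite /mult -cats1 count_cat /= addn0 [r == i]eq_sym. Qed.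

Lemma take_rcons u x : x < size u -> take x.+1 u = rcons (take x u) (nth 0 u x).
Proof. exact: take_nth. Qed.

Lemma array_word_exists n A : is_ABC n n A -> exists u, array_word n A u.
Proof.
move=> [sA _ _ ABC].
suff H x : x <= n -> exists u, [/\ yam u, size u = x &
    forall y, y <= x -> raw_shape A y = mkseq (mult (take y u)) y].
  by have [u [? ? ?]] := H n (leqnn n); exists u.
elim: x => [_|x IHx xn].
  by exists [::]; split=> // y; rewrite leqn0 => /eqP ->.
have [u [yu ux rawE]] := IHx (ltnW xn).
have [srt /andP [_ nu_core] _ _ [c strip]] := ABC x.+1 xn.
have laE : abc_shape A x.+1.-1 = word_shape u.
  by rewrite /abc_shape rawE // /word_shape ux take_oversize // ux.
rewrite laE in strip.
have la_small : sumn (word_shape u) < n by rewrite sumn_shape // ux.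
have [r box] := chain_box (is_part_shape yu) la_small strip.
have nu_part : is_part (abc_shape A x.+1) by case/andP: nu_core.
have {}box i : nth 0 (raw_shape A x.+1) i = mult u i + (i == r).
  by rewrite -nth_pos_filter // -/(abc_shape A x.+1) box nth_shape.
have yur : yam (rcons u r).
  rewrite yam_rcons yu; case: (posnP r) => //= r0.
  have := nth_sorted_geq srt (leq_pred r); rewrite !box eqxx addn1.
  by rewrite ltn_eqF ?addn0 // prednK.
exists (rcons u r); split=> // [|y]; first by rewrite size_rcons ux.
rewrite leq_eqVlt => /predU1P [->|yx].
  rewrite take_oversize ?size_rcons ?ux //.
  have sz : size (raw_shape A x.+1) = x.+1 by rewrite size_map size_iota.
  apply: (@eq_from_nth _ 0) => [|i]; rewrite sz ?size_mkseq // => ix.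
  by rewrite nth_mkseq // box mult_rcons.
by rewrite rawE // -cats1 takel_cat // ux.
Qed.

Lemma array_word_uniq n A u v : array_word n A u -> array_word n A v -> u = v.
Proof.
move=> [yu un Hu] [yv vn Hv].
have multE x r : x <= n -> mult (take x u) r = mult (take x v) r.
  move=> xn; case: (ltnP r x) => rx; last first.
    by rewrite /mult !yam_count0 ?yam_take // size_takel ?un ?vn.
  by have := congr1 (fun s => nth 0 s r) (Hu x xn); rewrite Hv // !nth_mkseq.
apply: (@eq_from_nth _ 0) => [|x]; rewrite un ?vn // => xn.
have := multE x.+1 (nth 0 u x) xn; rewrite !take_rcons ?un ?vn // !mult_rcons eqxx.
rewrite multE ?(ltnW xn) // => /addnI; case: eqP => //.
Qed.

Lemma prefix_count (p : pred nat) s :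
  (forall i j, i < j < size s -> p (nth 0 s j) -> p (nth 0 s i)) ->
  forall j, j < size s -> p (nth 0 s j) = (j < count p s).
Proof.
elim: s => //= x s IHs pre j js.
have {}IHs := IHs (fun i k (ik : i < k < size s) => pre i.+1 k.+1 ik).
case px: (p x) => /=; first by case: j js => // j js; rewrite add1n ltnS IHs.
have s0 k : k < size s -> p (nth 0 s k) = false.
  by move=> ks; apply/negP => /(pre 0 k.+1 ks); rewrite /= px.
have -> : count p s = 0.
  apply/eqP; rewrite -leqn0 leqNgt -has_count; apply/negP => /(has_nthP 0) [k ks].
  by rewrite s0.
by case: j js => [|j] js /=; rewrite ?px // s0.
Qed.

Lemma wf_row_prefix r x i j : wf_row r -> i < j < size r ->
  let p e := (e == 0) || (x < e) in p (nth 0 r j) -> p (nth 0 r i).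
Proof.
rewrite /wf_row /=; set f := find _ r => /andP [s0 srt] /andP [ij jr].
case: (ltnP i f) => fi.
  by have := before_find 0 fi => /= /negbFE ->.
have nthE k : f <= k -> nth 0 r k = nth 0 (drop f r) (k - f) by move=> fk; rewrite nth_drop subnKC.
rewrite (nthE i fi) (nthE j (leq_trans fi (ltnW ij))).
case/orP => [/eqP nth0j|xj].
  case/negP: s0; rewrite -nth0j; apply: mem_nth; rewrite size_drop ltn_sub2r //.
  by rewrite (leq_ltn_trans fi) // (ltn_trans ij).
by rewrite (leq_trans xj) ?orbT // nth_sorted_geq // leq_sub2r // ltnW.
Qed.

Lemma wf_rowI r :
  (forall i j, i < j < size r -> nth 0 r j = 0 -> nth 0 r i = 0) ->
  (forall i j, i < j < size r -> nth 0 r i != 0 -> nth 0 r j <= nth 0 r i) -> wf_row r.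
Proof.
rewrite /wf_row; elim: r => // e r IHr h0 hle.
case: (eqVneq e 0) => [->|e0] /=.
  apply: IHr => i j; [exact: (h0 i.+1 j.+1)|exact: (hle i.+1 j.+1)].
rewrite e0 /= inE eq_sym (negPf e0) /=; apply/andP; split.
  apply/negP => /(nthP 0) [k kr k0].
  by case/eqP: e0; apply: (h0 0 k.+1).
apply/(pathP 0) => i ir; apply: (hle i i.+1); first by rewrite ltnSn.
by case: i ir => // i ir; apply: contraNneq e0 => /(h0 0 i.+1 (ltnW ir)) /= ->.
Qed.

Lemma nth_raw_shape A x i : 0 < i <= x -> nth 0 (raw_shape A x) (x - i) =
  count (fun e => (e == 0) || (x < e)) (abc_row A i).
Proof.
move=> ix; rewrite (nth_map 0) ?size_iota ?nth_iota; try lia.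
by congr (count _ (abc_row A _)); lia.
Qed.

(** In each row, the cells that are empty or larger than x form an initial segment whose length is a
    part of lambda^(x); these lengths for all x recover the entries. *)
Lemma array_word_inj n A B u : is_ABC n n A -> is_ABC n n B ->
  array_word n A u -> array_word n B u -> A = B.
Proof.
move=> [sA /allP wA _ hA] [sB /allP wB _ hB] Au Bu.
have [_ _ rawA] := Au; have [_ _ rawB] := Bu.
apply: (@eq_from_nth _ [::]) => [|k]; rewrite sA ?sB // => kn.
have [_ _ szA entA _] := hA k.+1 kn; have [_ _ szB entB _] := hB k.+1 kn.
rewrite /abc_row /= in szA szB entA entB.
have sz : size (nth [::] A k) = size (nth [::] B k).
  by rewrite szA szB !(@abc_shape_word n _ u) // ltnW.
have /andP [wfA /allP leA] : wf_row (nth [::] A k) && all (fun e => e <= n) (nth [::] A k).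
  by apply: wA; rewrite mem_nth ?sA.
have /andP [wfB /allP leB] : wf_row (nth [::] B k) && all (fun e => e <= n) (nth [::] B k).
  by apply: wB; rewrite mem_nth ?sB.
apply: (@eq_from_nth _ 0) => // j jA; have jB : j < size (nth [::] B k) by rewrite -sz.
have key x : k < x <= n ->
    ((nth 0 (nth [::] A k) j == 0) || (x < nth 0 (nth [::] A k) j)) =
    ((nth 0 (nth [::] B k) j == 0) || (x < nth 0 (nth [::] B k) j)).
  move=> kx; have [kx' xn] := andP kx.
  rewrite (prefix_count (p := fun e => (e == 0) || (x < e)) _ jA);
    first rewrite (prefix_count (p := fun e => (e == 0) || (x < e)) _ jB).
  - rewrite -[nth [::] A k]/(abc_row A k.+1) -[nth [::] B k]/(abc_row B k.+1).
    by rewrite -!nth_raw_shape // rawA // rawB.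
  - by move=> i j' ij; apply: wf_row_prefix.
  - by move=> i j' ij; apply: wf_row_prefix.
have eA := leA _ (mem_nth 0 jA); have eB := leB _ (mem_nth 0 jB).
have iA := allP entA _ (mem_nth 0 jA); have iB := allP entB _ (mem_nth 0 jB).
move: (nth 0 (nth [::] A k) j) (nth 0 (nth [::] B k) j) key eA eB iA iB => e e' key eA eB /= iA iB.
(* The instance x = n separates empty cells from the others; x = e and x = e' then compare the two
   entries. *)
have keyn := key n; have keye := key e; have keye' := key e'.
lia.
Qed.

Section WordArray.

Variables (n : nat) (u : seq nat).
Hypotheses (yam_u : yam u) (un : size u = n).
Local Notation R x := (mult (take x u)).

Lemma mult_take_mono x y r : x <= y -> R x r <= R y r.
Proof.
move=> xy; have -> : take x u = take x (take y u) by rewrite take_takel.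
by rewrite /mult -{2}(cat_take_drop x (take y u)) count_cat leq_addr.
Qed.

Lemma mult_take_diag x r : x < n -> R x.+1 r.+1 <= R x r.
Proof.
move=> xn; have yx := yam_take x.+1 yam_u; move: yx.
rewrite take_rcons ?un // yam_rcons mult_rcons => /andP [yx].
case: (eqVneq r.+1 (nth 0 u x)) => [<- /=|_ _]; first by rewrite addn1.
by rewrite addn0; apply: yam_count.
Qed.

(** Row [i] of the array is row x - i of lambda^(x). Its length decreases as x grows, so each cell
    leaves the shape once and for all. *)
Lemma mult_take_anti i x y : i <= x -> x <= y -> y <= n -> R y (y - i) <= R x (x - i).
Proof.
move=> ix /subnK <-; elim: (y - x) => // d IHd dn.
apply: leq_trans (IHd (ltnW dn)); rewrite addSn subSn; last by rewrite (leq_trans ix) // leq_addl.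
exact: mult_take_diag.
Qed.

(** A cell still in lambda^(n) is empty; any other one receives the first x >= i for which it is
    outside lambda^(x). *)
Definition word_entry (i j : nat) : nat :=
  if j < R n (n - i) then 0
  else i + find (fun x => R x (x - i) <= j) (iota i (n.+1 - i)).

Lemma word_entryP i j x : 0 < i -> i <= x <= n ->
  ((word_entry i j == 0) || (x < word_entry i j)) = (j < R x (x - i)).
Proof.
move=> i0 /andP [ix xn]; rewrite /word_entry; case: ltnP => jn /=.
  by rewrite (leq_trans jn) ?mult_take_anti.
set f := find _ _.
have hasf : has (fun x => R x (x - i) <= j) (iota i (n.+1 - i)).
  by apply/hasP; exists n => //; rewrite mem_iota; lia.
have fs : f < n.+1 - i by move: hasf; rewrite has_find size_iota.
have := nth_find 0 hasf; rewrite -/f nth_iota // => fj.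
rewrite addn_eq0 (gtn_eqF i0) /=; case: (ltnP x (i + f)) => xf.
  have xi : x - i < f by lia.
  have := before_find 0 xi; rewrite nth_iota ?subnKC //; last by lia.
  by move=> /negbT; rewrite -ltnNge.
apply/esym/negbTE; rewrite -leqNgt; apply: leq_trans fj.
by apply: mult_take_anti => //; lia.
Qed.

Lemma word_entry_bounds i j : 0 < i <= n -> (word_entry i j == 0) || (i <= word_entry i j <= n).
Proof.
move=> /andP [i0 i_n]; rewrite /word_entry; case: ltnP => jn //=.
apply/orP; right; rewrite leq_addr /=.
have hasf : has (fun x => R x (x - i) <= j) (iota i (n.+1 - i)).
  by apply/hasP; exists n => //; rewrite mem_iota; lia.
by move: hasf; rewrite has_find size_iota; lia.
Qed.

Definition word_row (i : nat) : seq nat := mkseq (word_entry i) (n + R i.-1 0).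

Definition word_array : seq (seq nat) := [seq word_row i | i <- iota 1 n].

Lemma abc_row_word_array i : 0 < i <= n -> abc_row word_array i = word_row i.
Proof.
by move=> /andP [i0 i_n]; rewrite /abc_row (nth_map 0) ?size_iota ?nth_iota ?add1n prednK.
Qed.

Lemma word_row_count i x : 0 < i -> i <= x <= n ->
  count (fun e => (e == 0) || (x < e)) (word_row i) = R x (x - i).
Proof.
move=> i0 ixn; rewrite /word_row /mkseq count_map.
rewrite (eq_count (a2 := fun j => j < R x (x - i))) => [|j]; last exact: word_entryP.
have le_size : R x (x - i) <= n + R i.-1 0.
  case/andP: ixn => ix xn; apply: leq_trans (mult_take_anti (leqnn i) ix xn) _.
  rewrite subnn -[in R i](prednK i0) take_rcons ?un; last by rewrite prednK // (leq_trans ix).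
  rewrite mult_rcons addnC leq_add2r (leq_trans (leq_b1 _)) //.
  by rewrite (leq_trans i0) // (leq_trans ix).
rewrite -(subnKC le_size) iotaD count_cat add0n.
rewrite (eq_in_count (a2 := predT)) => [|j]; last by rewrite mem_iota add0n => /andP [_ ->].
rewrite count_predT size_iota (eq_in_count (a2 := pred0)) ?count_pred0 ?addn0 // => j.
by rewrite mem_iota => /andP [h _]; rewrite ltnNge h.
Qed.

Lemma word_array_raw x : x <= n -> raw_shape word_array x = mkseq (R x) x.
Proof.
move=> xn; apply: (@eq_from_nth _ 0); first by rewrite size_mkseq size_map size_iota.
move=> k; rewrite size_map size_iota => kx.
rewrite nth_mkseq // -{1}[k](subKn (ltnW kx)) nth_raw_shape; last by lia.
rewrite abc_row_word_array; last by lia.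
rewrite word_row_count; try lia.
by rewrite subKn // ltnW.
Qed.

Lemma array_word_word_array : array_word n word_array u.
Proof. by split=> // x; apply: word_array_raw. Qed.

Lemma size_word_row i : size (word_row i) = n + R i.-1 0.
Proof. exact: size_mkseq. Qed.

Lemma entry_word_array i j : entry word_array i j != 0 -> 0 < i ->
  i <= n /\ entry word_array i j = word_entry i j.
Proof.
rewrite /entry => ne i0; case: (leqP i n) => i_n; last first.
  rewrite /abc_row [nth [::] _ i.-1]nth_default ?nth_nil // in ne.
  by rewrite size_map size_iota; lia.
split=> //; move: ne; rewrite abc_row_word_array ?i0 //.
case: (ltnP j (size (word_row i))) => jr; last by rewrite nth_default.
by rewrite /word_row nth_mkseq // -size_word_row.
Qed.

Lemma word_array_ABC : is_ABC n n word_array.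
Proof.
have wordE x : x <= n -> abc_shape word_array x = word_shape (take x u).
  exact: abc_shape_word array_word_word_array.
have sizeT x : x <= n -> size (take x u) = x by move=> xn; rewrite size_takel ?un.
split=> [||i i' j /andP [i0 ii'] ne ne'|i i_n].
- by rewrite size_map size_iota.
- apply/allP => r /mapP [i]; rewrite mem_iota add1n ltnS => i_n ->.
  have [i0 in'] := andP i_n.
  apply/andP; split; last first.
    apply/allP => e /mapP [j _ ->].
    by case/orP: (word_entry_bounds j i_n) => [/eqP ->|/andP []].
  apply: wf_rowI => k j; rewrite size_word_row => /andP [kj jr].
    rewrite !nth_mkseq ?(ltn_trans kj) // => E.
    have := word_entryP j i0 (_ : i <= n <= n); rewrite in' leqnn E => /(_ isT) /esym jn.
    have := word_entryP k i0 (_ : i <= n <= n); rewrite in' leqnn => /(_ isT).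
    rewrite (ltn_trans kj jn) => /orP [/eqP //|].
    by case/orP: (word_entry_bounds k i_n) => [/eqP //|/andP [_ h]]; rewrite ltnNge h.
  rewrite !nth_mkseq ?(ltn_trans kj) // => E.
  have ixn : i <= word_entry i k <= n by move: (word_entry_bounds k i_n); rewrite (negPf E).
  have := word_entryP k i0 ixn; rewrite (negPf E) ltnn /= => /esym /negbT.
  rewrite -leqNgt => kP; have := word_entryP j i0 ixn.
  rewrite [RHS]ltnNge (leq_trans kP (ltnW kj)) /= => /negbT.
  by rewrite negb_or -leqNgt => /andP [].
- have [i_n E] := entry_word_array ne i0.
  have i'0 : 0 < i' := leq_trans i0 (ltnW ii').
  have [i'_n E'] := entry_word_array ne' i'0.
  rewrite E E' in ne ne' *; set y := word_entry i' j in ne' *.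
  have yb : i' <= y <= n.
    by have := word_entry_bounds j (_ : 0 < i' <= n); rewrite i'0 i'_n -/y (negPf ne') => /(_ isT).
  have [i'y yn] := andP yb.
  have := word_entryP j i'0 yb; rewrite -/y (negPf ne') ltnn /= => /esym /negbT.
  rewrite -leqNgt => yj.
  have h : i <= y.-1 <= n by lia.
  have := word_entryP j i0 h; rewrite (negPf ne) /= [RHS]ltnNge.
  (* At stage y - 1, row [i] of the array is row y - 1 - i of the shape, weakly above the row y - i'
     that no longer contains column j at stage y. So the cell in row [i] has left by stage y - 1. *)
  have -> : R y.-1 (y.-1 - i) <= j.
    apply: leq_trans (mult_take_mono _ (leq_pred y)) _; apply: leq_trans yj.
    by apply: yam_count_le; [exact: yam_take | lia].
  by move=> /negbT; rewrite -leqNgt; lia.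
have [i0 in'] := andP i_n; have in'' : i.-1 <= n by lia.
have yT x := yam_take x yam_u.
split.
- by rewrite word_array_raw //; apply: sorted_mult.
- by rewrite !wordE // !small_core ?is_part_shape ?sumn_shape ?sizeT.
- rewrite abc_row_word_array // size_word_row wordE //.
  by rewrite -nth0 nth_shape.
- rewrite abc_row_word_array //; apply/allP => e /mapP [j _ ->].
  by case/orP: (word_entry_bounds j i_n) => [->|/andP [-> _]] //; rewrite orbT.
rewrite !wordE //; apply: (@strip_chain_exists n _ _ (nth 0 u i.-1)).
- exact: is_part_shape.
- by rewrite sumn_shape // sizeT //; lia.
- exact: is_part_shape.
move=> k; rewrite !nth_shape // -{1}(prednK i0) take_rcons ?mult_rcons //.
by rewrite un; lia.
Qed.

End WordArray.

Lemma flatten_pairmapP (T : Type) (U : eqType) (f : T -> T -> seq U) (x0 x : T) s y :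
  reflect (exists2 i, i < size s & y \in f (nth x0 (x :: s) i) (nth x0 s i))
          (y \in flatten (pairmap f x s)).
Proof.
apply: (iffP flattenP) => [[z /(nthP [::]) [i]]|[i is_ yi]].
  by rewrite size_pairmap => is_ <- yz; exists i => //; rewrite -(nth_pairmap x0 [::]).
exists (f (nth x0 (x :: s) i) (nth x0 s i)) => //.
by rewrite -(nth_pairmap x0 [::]) // mem_nth // size_pairmap.
Qed.

(** * Spin and descents *)

Section Spin.

Variables (n : nat) (A : seq (seq nat)) (u : seq nat).
Hypotheses (A_abc : is_ABC n n A) (A_word : array_word n A u).

Let yam_u : yam u. Proof. by case: A_word. Qed.
Let un : size u = n. Proof. by case: A_word. Qed.
Local Notation row l := (nth 0 u l.-1).
Local Notation column l := (mult (take l.-1 u) (row l)).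
Local Notation domino_col l := (n.+1 + column l - row l).

Section OneLetter.

Variable l : nat.
Hypothesis l_n : 0 < l <= n.
Local Notation la := (word_shape (take l.-1 u)).
Local Notation nu := (word_shape (take l u)).

Let yT x : yam (take x u). Proof. exact: yam_take. Qed.

Lemma letter_part : is_part la. Proof. exact: is_part_shape. Qed.

Lemma letter_small : sumn la < n.
Proof. by rewrite sumn_shape // size_takel ?un; lia. Qed.

Lemma letter_box i : nth 0 nu i = nth 0 la i + (i == row l).
Proof.
rewrite !nth_shape // -mult_rcons -take_rcons; last by rewrite un; lia.
by rewrite prednK //; case/andP: l_n.
Qed.

(** The results on strip chains hold for every such chain, hence for the one picked by [xget]. *)
Lemma letter_chain : strip_chain n 1 la nu (the_chain n A l).
Proof.
have [_ _ _ /(_ l l_n) [_ _ _ _ [c hc]]] := A_abc.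
have l_n' : l.-1 <= n by lia.
have [_ ln] := andP l_n.
rewrite /the_chain !(abc_shape_word A_word) // in hc *.
by case: xgetP => [c' _ //|/(_ c)].
Qed.

Lemma letter_size : size (the_chain n A l) = n.-1.
Proof. exact: chain_size letter_chain. Qed.

End OneLetter.

Lemma ribbonsP R : reflect (exists l i, [/\ 0 < l <= n, i < n.-1 &
    exists2 R', R' \in components (skew_cells
        (nth [::] (word_shape (take l u) :: the_chain n A l) i.+1)
        (nth [::] (word_shape (take l u) :: the_chain n A l) i)) &
      R = [seq to_array n l x | x <- R']]) (R \in ribbons n n A).
Proof.
apply: (iffP flatten_mapP) => [[l]|[l [i [l_n i_n [R' R'c ->]]]]].
  rewrite mem_iota add1n ltnS => l_n; have [_ ln] := andP l_n.
  case/(flatten_pairmapP _ [::]) => i; rewrite letter_size // => i_n.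
  rewrite (abc_shape_word A_word) // => /mapP [R' R'c ->].
  by exists l, i; split=> //; exists R'.
have [_ ln] := andP l_n.
exists l; first by rewrite mem_iota add1n ltnS.
apply/(flatten_pairmapP _ [::]); exists i; first by rewrite letter_size.
rewrite (abc_shape_word A_word) //; apply/mapP; exists R' => //.
Qed.

(** Dominoes lie in the bottom row of the shape, which for the letter [l] is array row n + 1 - l, so
    an array row has dominoes of a single letter. *)
Lemma two_ribbons_domino i R : R \in two_ribbons n n A i ->
  exists l, [/\ 0 < l <= n, i = n.+1 - l, 0 < row l & head_col R = domino_col l].
Proof.
rewrite mem_filter => /andP [/andP [/eqP sR aR] /ribbonsP [l [k [l_n k_n [R' R'c RE]]]]].
have sR' : size R' = 2 by rewrite -sR RE size_map.
have [j aj] : exists j, (i = n.+1 - l + j) /\ all (fun x => x.1 == j) R'.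
  move: aR; rewrite RE all_map => aR.
  case: R' sR' aR {RE R'c} => // x R' _ /= /andP [/eqP xi aR]; exists x.1; split=> //.
  rewrite eqxx /=; apply: sub_all aR => y /=; rewrite -xi /to_array /= eqn_add2l //.
have [iE {}aj] := aj.
have [r0 j0 hd] := chain_domino (letter_part l) (letter_small l_n) (letter_chain l_n)
  (letter_box l_n) k_n R'c sR' aj.
exists l; split=> //; first by rewrite iE j0 addn0.
rewrite nth_shape ?yam_take // in hd; rewrite -hd RE /head_col big_map.
by apply: eq_bigr.
Qed.

Lemma two_ribbons_exists l : 0 < l <= n -> 0 < row l ->
  exists R, R \in two_ribbons n n A (n.+1 - l).
Proof.
move=> l_n r0; have [k k_n [R R_c /andP [sR aR]]] := chain_domino_exists (letter_part l)
  (letter_small l_n) (letter_chain l_n) (letter_box l_n) r0.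
exists [seq to_array n l x | x <- R]; rewrite mem_filter size_map sR all_map /=.
apply/andP; split; last by apply/ribbonsP; exists l, k; split=> //; exists R.
by apply: sub_all aR => x /= /eqP ->; rewrite addn0.
Qed.

(** Up to the constant n + 1, [domino_col] is the content of a box. When box d + 1 lies weakly below
    box d it is in a later column, so the content grows; when it lies strictly above, the content
    does not grow. A box in row 0 has no domino. *)
Lemma descent_domino d : 0 < d < n ->
  (nth 0 u d.-1 < nth 0 u d) =
  (0 < row d.+1) && ~~ ((0 < row d) && (domino_col d < domino_col d.+1)).
Proof.
move=> dn; rewrite /=; set s := nth 0 u d.-1; set r := nth 0 u d.
have yT x : yam (take x u) by exact: yam_take.
have takeS : take d u = rcons (take d.-1 u) s.
  by rewrite -take_rcons ?un ?prednK //; lia.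
have : yam (rcons (take d u) r) by rewrite -take_rcons ?un //; lia.
rewrite yam_rcons => /andP [_ yr].
have : yam (rcons (take d.-1 u) s) by rewrite -takeS.
rewrite yam_rcons => /andP [_ ys].
have multS k : mult (take d u) k = mult (take d.-1 u) k + (k == s) by rewrite takeS mult_rcons.
have le_s : s <= n.
  have : s < size (take d u) by apply: yam_lt_size (yT d) _; rewrite takeS mem_rcons mem_head.
  by rewrite size_takel ?un; lia.
have anti x y : x <= y -> mult (take d u) y <= mult (take d u) x by apply: yam_count_le.
have anti' x y : x <= y -> mult (take d.-1 u) y <= mult (take d.-1 u) x by apply: yam_count_le.
case: (ltnP s r) => sr.
  have r0 : 0 < r by lia.
  rewrite r0 /=; apply/esym; rewrite negb_and -leqNgt; apply/orP; right.
  have : mult (take d u) r < mult (take d u) r.-1 by move: yr; rewrite (gtn_eqF r0).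
  have := anti s r.-1; rewrite [mult (take d u) s]multS eqxx; lia.
case: (posnP r) => //= r0; apply/esym/negbTE; rewrite negbK.
have s0 : 0 < s := leq_trans r0 sr.
rewrite s0 /=.
have : mult (take d.-1 u) s < mult (take d.-1 u) s.-1.
  by move: ys; rewrite (gtn_eqF s0).
case: (ltngtP r s) sr => // [rs _|-> _ _]; last by rewrite multS eqxx; lia.
by have := anti' r s.-1; rewrite multS; lia.
Qed.

Lemma row1 : row 1 = 0.
Proof.
have := yam_take 1 yam_u; case: (u) => [|a v] //=.
by rewrite take0 -[[:: a]]/(rcons [::] a) yam_rcons /= orbF => /eqP.
Qed.

Lemma chi_descent l : 0 < l <= n ->
  chi n n A (n.+1 - l) = (1 < l) && (nth 0 u l.-2 < nth 0 u l.-1).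
Proof.
move=> l_n; case: (ltnP 1 l) => l1 /=; last first.
  have -> : l = 1 by lia.
  apply/negbTE/hasPn => R /two_ribbons_domino [l' [l'n lE + _]].
  have -> : l' = 1 by lia.
  by rewrite row1.
have d_n : 0 < l.-1 < n by lia.
have lS : l.-1.+1 = l by lia.
rewrite (descent_domino d_n) lS.
have iS : (n.+1 - l).+1 = n.+1 - l.-1 by lia.
rewrite /chi iS; apply/hasP/andP => [[R Rl nR]|[r0 nE]].
  have [l' [l'n lE r0 hR]] := two_ribbons_domino Rl.
  have ll' : l' = l by lia.
  rewrite ll' in r0 hR; split=> //; apply/negP => /andP [r0' lt_col].
  have l1n : 0 < l.-1 <= n by lia.
  have [R' R'l] := two_ribbons_exists l1n r0'.
  case/negP: nR; apply/hasP; exists R' => //.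
  have [l'' [l''n lE' r0'' hR']] := two_ribbons_domino R'l.
  have ll'' : l'' = l.-1 by lia.
  by rewrite ll'' in hR'; rewrite /east_of hR hR'.
have [R Rl] := two_ribbons_exists l_n r0; exists R => //.
apply/negP => /hasP [R' R'l]; rewrite /east_of.
have [l' [l'n lE _ ->]] := two_ribbons_domino Rl.
have [l'' [l''n lE' r0' ->]] := two_ribbons_domino R'l.
have -> : l' = l by lia.
have ll'' : l'' = l.-1 by lia.
by rewrite ll'' in r0' * => lt_col; rewrite r0' lt_col in nE.
Qed.

Lemma spin_descents :
  spin n n A = \sum_(1 <= d < n) (n - d) * (nth 0 u d.-1 < nth 0 u d).
Proof.
(* Reversing the sum indexes array rows by their letters l; with d = l - 1 the row number n + 1 - l
   is n - d, and l = 1 contributes nothing. *)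
rewrite /spin big_nat_rev /= add1n.
transitivity (\sum_(1 <= l < n.+1)
    (n.+1 - l) * ((1 < l) && (nth 0 u l.-2 < nth 0 u l.-1))).
  apply: eq_big_nat => l l_n; rewrite subSS.
  by rewrite -chi_descent.
case: (n) => [|m]; first by rewrite !big_geq.
rewrite big_ltn // muln0 add0n big_add1 /=; apply: eq_big_nat => d /andP [d0 dm].
by rewrite subSS ltnS d0.
Qed.

End Spin.

(** * The weight-preserving bijection *)

Local Open Scope ring_scope.

Lemma desc_wt_spin (F : fieldType) (t : F) (n : nat) (u : seq nat) : size u = n ->
  desc_wt (fun d => t ^+ (n - d)) u =
  t ^+ (\sum_(1 <= d < n) (n - d) * (nth 0 u d.-1 < nth 0 u d))%N.
Proof.
move=> un; rewrite /desc_wt un -prodrXr; apply: eq_bigr => d _.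
by case: ifP => _; rewrite ?muln1 // muln0.
Qed.

Lemma abc_rows_inj (k n : nat) : injective (@abc_rows k n).
Proof.
move=> A B /inj_map AB; apply/val_inj/AB => r s /(inj_map val_inj).
exact: val_inj.
Qed.

Theorem theorem5p1 (n : nat) (hn : (1 <= n)%N) (la : seq nat)
    (hla : is_part_of n la) :
  macdonald_K_q0 la (nseq n 1%N) =
  \sum_(A : abc_array n n |
          `[< is_ABC n n (abc_rows A) /\ inner_shape n (abc_rows A) = la >])
     t_Qt ^+ spin n n (abc_rows A).
Proof.
rewrite macdonald_K_q0_column // /desc_coef.
pose word (A : abc_array n n) : seq nat := xget [::] [set u | array_word n (abc_rows A) u]%classic.
have wordP A : is_ABC n n (abc_rows A) -> array_word n (abc_rows A) (word A).
  by move=> /array_word_exists [u hu]; rewrite /word; case: xgetP => [v _ //|/(_ u)].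
rewrite -big_filter -[RHS]big_filter.
(* Coding by words is a bijection from the arrays of inner shape [la] to the standard tableaux of
   shape [la], with inverse [word_array]. *)
have perm : perm_eq [seq u <- words n n | yam u && (word_shape u == la)]
    [seq word A | A <- [seq A <- index_enum (abc_array n n) |
       `[< is_ABC n n (abc_rows A) /\ inner_shape n (abc_rows A) = la >]]].
  apply: uniq_perm; first by rewrite filter_uniq ?uniq_words.
    rewrite map_inj_in_uniq ?filter_uniq ?index_enum_uniq // => A B.
    rewrite !mem_filter => /andP [/asboolP [hA _] _] /andP [/asboolP [hB _] _] AB.
    apply: abc_rows_inj; apply: (array_word_inj hA hB (wordP A hA)).
    by rewrite AB; exact: wordP.
  move=> u; rewrite mem_filter mem_words; apply/idP/mapP.
    move=> /and3P [/andP [yu /eqP su] /eqP un _].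
    have [A AE] := is_ABC_abc_array (word_array_ABC yu un).
    have Au : array_word n (abc_rows A) u by rewrite AE; exact: array_word_word_array.
    have hA : is_ABC n n (abc_rows A) by rewrite AE; exact: word_array_ABC.
    exists A; last exact: array_word_uniq Au (wordP A hA).
    rewrite mem_filter mem_index_enum andbT; apply/asboolP; split=> //.
    by rewrite /inner_shape (abc_shape_word Au) // take_oversize ?un.
  move=> [A]; rewrite mem_filter => /andP [/asboolP [hA inA] _] ->.
  have hw := wordP A hA; have [yw wn _] := hw.
  rewrite yw wn eqxx /= -inA /inner_shape (abc_shape_word hw) // take_oversize ?wn // eqxx.
  by apply/allP => r /(yam_lt_size yw); rewrite wn.
rewrite (perm_big _ perm) big_map big_seq [RHS]big_seq; apply: eq_bigr => A.
rewrite mem_filter => /andP [/asboolP [hA _] _]; have hw := wordP A hA.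
by rewrite (spin_descents hA hw) desc_wt_spin //; case: hw.
Qed.
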